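(* Let $\Bbbk$ be an algebraically closed field, and let $\mathcal{C}$ be a rigid Cauchy complete $\Bbbk$-linear braided monoidal category with finite dimensional morphism spaces and $\operatorname{End}(\mathbf{1})=\Bbbk$. If $\mathcal{C}$ has moderate growth, then $\mathcal{C}$ admits a semisimplification $\overline{\mathcal{C}}$, which is a semisimple braided tensor category of moderate growth whose Grothendieck ring is $K(\mathcal{C})$.
   Context: A linear category is Cauchy complete if it admits (finite) direct sums and is idempotent (Karoubi) complete. $\mathbf{1}$ denotes the monoidal unit. A category is rigid if every object has a left and a right dual. An object $X$ has moderate growth if there exists $n\in\mathbb{N}$ such that $\dim_{\Bbbk}\operatorname{End}(X^{\otimes n})<n!$; a category has moderate growth if all its indecomposable objects do. A tensor category over $\Bbbk$ is a $\Bbbk$-linear abelian rigid monoidal category with finite dimensional Hom spaces, objects of finite length, bilinear tensor product, and $\operatorname{End}(\mathbf{1})=\Bbbk$. Quantum trace: for rigid $X$ with dual $X^*$, $\operatorname{ev}_X:X^*\otimes X\to\mathbf{1}$, $\operatorname{coev}_X:\mathbf{1}\to X\otimes X^*$, and braiding $c$, the quantum trace is $\operatorname{Tr}_X:\operatorname{End}(X)\to\operatorname{End}(\mathbf{1})=\Bbbk$, $\operatorname{Tr}_X(f):=\operatorname{ev}_{X}\circ(\operatorname{id}_{X^*}\otimes f)\circ c_{X,X^*}\circ\operatorname{coev}_X$. Semisimplification: a morphism $f:X\to Y$ in $\mathcal{C}$ is called negligible if $\operatorname{Tr}_X(g\circ f)=0$ for all $g:Y\to X$. The semisimplification $\overline{\mathcal{C}}$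 is the quotient of $\mathcal{C}$ by the tensor ideal of negligible morphisms (same objects, Hom spaces divided by the negligible morphisms), with the induced braided monoidal structure. Non-negligible objects and $K(\mathcal{C})$: an indecomposable object $X\in\mathcal{C}$ is non-negligible if there exists $Y\in\mathcal{C}$ such that $\mathbf{1}$ is a direct summand of $Y\otimes X$; otherwise it is negligible. Direct sums of negligible indecomposable objects form a thick tensor ideal $\mathcal{I}\subset\mathcal{C}$ (if $X\in\mathcal{C}$, $Z\in\mathcal{I}$ then $X\otimes Z\in\mathcal{I}$). $K(\mathcal{C})$ is the Green ring of $\mathcal{C}/\mathcal{I}$: it has $\mathbb{Z}_+$-basis the isomorphism classes of non-negligible objects of $\mathcal{C}$, and the product of the classes of $X$ and $Y$ is the sum, with multiplicity, of the classes of the non-negligible indecomposable summands of $X\otimes Y$. *)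

(* Defs.v *)
From HB Require Import structures.
From mathcomp Require Import all_boot all_order all_algebra.
From mathcomp Require Import boolp.

Set Implicit Arguments.
Unset Strict Implicit.
Unset Printing Implicit Defensive.

Import GRing.Theory.
Local Open Scope ring_scope.
Local Open Scope quotient_scope.

(* The quotient V / U of a finite dimensional vector space by a subspace: the *)
(* carrier is the quotient of zmodTypes of ring_quotient, which is equipped   *)
(* here with its structure of finite dimensional vector space.                *)

Section QuotientVectType.
Import VectorInternalTheory.
Variables (k : fieldType) (V : vectType k) (U : {vspace V}).

Definition quotv : Type := Quotient.quot (pred_of_vspace U).
HB.instance Definition _ := EqQuotient.on quotv.
HB.instance Definition _ := GRing.Zmodule.on quotv.

Definition quotv_pi : V -> quotv := \pi_(Quotient.quot (pred_of_vspace U)).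

Lemma quotv_piD u v : quotv_pi (u + v) = quotv_pi u + quotv_pi v.
Proof. by rewrite /quotv_pi raddfD. Qed.

Lemma quotv_eq u v : quotv_pi u = quotv_pi v <-> u - v \in U.
Proof. by rewrite (Quotient.idealrBE (pred_of_vspace U)); split=> /eqP. Qed.

Lemma quotv_eq0 u : quotv_pi u = 0 <-> u \in U.
Proof.
have <- : quotv_pi 0 = 0 by rewrite /quotv_pi raddf0.
by rewrite quotv_eq subr0.
Qed.

Lemma quotv_repr (q : quotv) : quotv_pi (repr q) = q.
Proof. exact: reprK. Qed.

Lemma quotv_repr_pi u : repr (quotv_pi u) - u \in U.
Proof. by apply/quotv_eq; rewrite quotv_repr. Qed.

Definition quotv_scale (a : k) (q : quotv) : quotv := quotv_pi (a *: repr q).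

Lemma quotv_piZ a u : quotv_pi (a *: u) = quotv_scale a (quotv_pi u).
Proof.
apply/quotv_eq; rewrite -scalerBr; apply: memvZ.
by rewrite -opprB memvN quotv_repr_pi.
Qed.

Fact quotv_scaleA a b q : quotv_scale a (quotv_scale b q) = quotv_scale (a * b) q.
Proof. by rewrite -(quotv_repr q) -!quotv_piZ scalerA. Qed.
Fact quotv_scale1 : left_id 1 quotv_scale.
Proof. by move=> q; rewrite -(quotv_repr q) -!quotv_piZ scale1r. Qed.
Fact quotv_scaleDr : right_distributive quotv_scale +%R.
Proof.
move=> a p q; rewrite -(quotv_repr p) -(quotv_repr q) -quotv_piD -!quotv_piZ.
by rewrite scalerDr quotv_piD.
Qed.
Fact quotv_scaleDl q : {morph quotv_scale^~ q : a b / a + b}.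
Proof. by move=> a b; rewrite -(quotv_repr q) -!quotv_piZ scalerDl quotv_piD. Qed.

HB.instance Definition _ := GRing.Zmodule_isLmodule.Build k quotv
  quotv_scaleA quotv_scale1 quotv_scaleDr quotv_scaleDl.

Lemma quotv_pi_is_linear : linear quotv_pi.
Proof. by move=> a u v; rewrite quotv_piD quotv_piZ. Qed.

Fact quotv_vect_iso : Vector.axiom (dim (subvs_of U^C%VS)) quotv.
Proof.
have piC u : u - projv U u \in U^C%VS := memv_projC U u.
have UC0 w : w \in U -> w \in U^C%VS -> w = 0.
  by move=> wU wC; apply/eqP; rewrite -memv0 -(capv_compl U) memv_cap wU.
pose g (q : quotv) : subvs_of U^C%VS := Subvs (piC (repr q)).
have gE u (w : subvs_of U^C%VS) : u - vsval w \in U -> g (quotv_pi u) = w.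
  move=> uwU; apply: val_inj; apply/eqP; rewrite -subr_eq0 /=; apply/eqP/UC0.
    rewrite addrAC; apply: memvB (memv_proj U _).
    by rewrite -(subrK u (repr _)) -addrA memvD ?quotv_repr_pi.
  exact: memvB (piC _) (subvsP w).
have g_lin : linear g.
  move=> a p q; rewrite -{1}(quotv_repr p) -{1}(quotv_repr q).
  rewrite -quotv_pi_is_linear; apply: gE; rewrite [vsval _]linearP opprD addrACA.
  by rewrite -scalerBr /= !subKr memvD ?memvZ ?memv_proj.
exists (fun q => v2r (g q)) => [a p q|]; first by rewrite g_lin linearP.
exists (fun r => quotv_pi (vsval (r2v r : subvs_of U^C%VS))) => [q|r].
  rewrite v2rK -{2}(quotv_repr q); apply/quotv_eq => /=.
  by rewrite addrAC subrr add0r memvN memv_proj.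
by rewrite (gE _ (r2v r)) ?r2vK // subrr mem0v.
Qed.

HB.instance Definition _ := Lmodule_hasFinDim.Build k quotv quotv_vect_iso.

End QuotientVectType.

Declare Scope cat_scope.
Delimit Scope cat_scope with cat.
Local Open Scope cat_scope.

Reserved Notation "g \oc f" (at level 45, left associativity).
Reserved Notation "X \ox Y" (at level 40, left associativity).
Reserved Notation "f \om g" (at level 40, left associativity).

Record lincat (k : fieldType) := Lincat {
  Ob : Type;
  Mor : Ob -> Ob -> vectType k;
  idm : forall X, Mor X X;
  comp : forall X Y Z, Mor Y Z -> Mor X Y -> Mor X Z
    where "g \oc f" := (comp g f);
  comp_linl : forall X Y Z (f : Mor X Y), linear (fun g : Mor Y Z => g \oc f);
  comp_linr : forall X Y Z (g : Mor Y Z), linear (fun f : Mor X Y => g \oc f);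
  comp1m : forall X Y (f : Mor X Y), idm Y \oc f = f;
  compm1 : forall X Y (f : Mor X Y), f \oc idm X = f;
  compA : forall W X Y Z (h : Mor Y Z) (g : Mor X Y) (f : Mor W X),
    h \oc (g \oc f) = h \oc g \oc f
}.

Notation "g \oc f" := (comp g f) : cat_scope.

Record moncat (k : fieldType) := Moncat {
  mon_lincat :> lincat k;
  tens : Ob mon_lincat -> Ob mon_lincat -> Ob mon_lincat
    where "X \ox Y" := (tens X Y);
  one : Ob mon_lincat;
  tensm : forall X X' Y Y', Mor X X' -> Mor Y Y' -> Mor (X \ox Y) (X' \ox Y')
    where "f \om g" := (tensm f g);
  assoc : forall X Y Z, Mor (X \ox Y \ox Z) (X \ox (Y \ox Z));
  assocV : forall X Y Z, Mor (X \ox (Y \ox Z)) (X \ox Y \ox Z);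
  lunit : forall X, Mor (one \ox X) X;
  lunitV : forall X, Mor X (one \ox X);
  runit : forall X, Mor (X \ox one) X;
  runitV : forall X, Mor X (X \ox one);
  tens_linl : forall X X' Y Y' (g : Mor Y Y'),
    linear (fun f : Mor X X' => f \om g);
  tens_linr : forall X X' Y Y' (f : Mor X X'),
    linear (fun g : Mor Y Y' => f \om g);
  tens1 : forall X Y, idm X \om idm Y = idm (X \ox Y);
  tens_comp : forall X X' X'' Y Y' Y''
      (f' : Mor X' X'') (f : Mor X X') (g' : Mor Y' Y'') (g : Mor Y Y'),
    (f' \oc f) \om (g' \oc g) = (f' \om g') \oc (f \om g);
  assocK : forall X Y Z, assocV X Y Z \oc assoc X Y Z = idm _;
  assocVK : forall X Y Z, assoc X Y Z \oc assocV X Y Z = idm _;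
  lunitK : forall X, lunitV X \oc lunit X = idm _;
  lunitVK : forall X, lunit X \oc lunitV X = idm _;
  runitK : forall X, runitV X \oc runit X = idm _;
  runitVK : forall X, runit X \oc runitV X = idm _;
  assoc_nat : forall X X' Y Y' Z Z' (f : Mor X X') (g : Mor Y Y') (h : Mor Z Z'),
    assoc X' Y' Z' \oc (f \om g \om h) = (f \om (g \om h)) \oc assoc X Y Z;
  lunit_nat : forall X X' (f : Mor X X'),
    lunit X' \oc (idm one \om f) = f \oc lunit X;
  runit_nat : forall X X' (f : Mor X X'),
    runit X' \oc (f \om idm one) = f \oc runit X;
  pentagon : forall W X Y Z,
    assoc W X (Y \ox Z) \oc assoc (W \ox X) Y Z =
    (idm W \om assoc X Y Z) \oc assoc W (X \ox Y) Z \oc (assoc W X Y \om idm Z);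
  triangle : forall X Y,
    (idm X \om lunit Y) \oc assoc X one Y = runit X \om idm Y
}.

Notation "X \ox Y" := (tens X Y) : cat_scope.
Notation "f \om g" := (tensm f g) : cat_scope.
Arguments one {k} C : rename.

Record bmcat (k : fieldType) := Bmcat {
  br_moncat :> moncat k;
  br : forall X Y : Ob br_moncat, Mor (X \ox Y) (Y \ox X);
  brV : forall X Y : Ob br_moncat, Mor (Y \ox X) (X \ox Y);
  brK : forall X Y, brV X Y \oc br X Y = idm _;
  brVK : forall X Y, br X Y \oc brV X Y = idm _;
  br_nat : forall (X X' Y Y' : Ob br_moncat) (f : Mor X X') (g : Mor Y Y'),
    br X' Y' \oc (f \om g) = (g \om f) \oc br X Y;
  hexagon1 : forall X Y Z,
    assoc Y Z X \oc br X (Y \ox Z) \oc assoc X Y Z =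
    (idm Y \om br X Z) \oc assoc Y X Z \oc (br X Y \om idm Z);
  hexagon2 : forall X Y Z,
    assocV Z X Y \oc br (X \ox Y) Z \oc assocV X Y Z =
    (br X Z \om idm Y) \oc assocV X Z Y \oc (idm X \om br Y Z)
}.

Section LinearCategories.
Variables (k : fieldType) (C : lincat k).
Implicit Types X Y Z S : Ob C.

Definition is_iso X Y (f : Mor X Y) : Prop :=
  exists g : Mor Y X, g \oc f = idm X /\ f \oc g = idm Y.

Definition isomorphic X Y : Prop := exists f : Mor X Y, is_iso f.

Definition is_zero X : Prop :=
  forall Y, (forall f : Mor X Y, f = 0) /\ (forall f : Mor Y X, f = 0).

(* S is the direct sum of the family Z; an empty family gives a zero object.  *)
Definition is_dsum (J : finType) (Z : J -> Ob C) S : Prop :=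
  exists (i : forall j, Mor (Z j) S) (p : forall j, Mor S (Z j)),
    [/\ forall j, p j \oc i j = idm (Z j),
        forall j l, j != l -> p j \oc i l = 0
      & \sum_j (i j \oc p j) = idm S].

Definition is_dsum2 X Y S : Prop := is_dsum (fun b : bool => if b then X else Y) S.

Definition direct_summand X S : Prop := exists Y, is_dsum2 X Y S.

Definition indecomposable X : Prop :=
  ~ is_zero X /\ forall Y Z, is_dsum2 Y Z X -> is_zero Y \/ is_zero Z.

Definition has_direct_sums : Prop :=
  forall n (Z : 'I_n -> Ob C), exists S, is_dsum Z S.

Definition idempotent_complete : Prop :=
  forall X (e : Mor X X), e \oc e = e ->
  exists Y (p : Mor X Y) (i : Mor Y X), p \oc i = idm Y /\ i \oc p = e.

Definition cauchy_complete : Prop := has_direct_sums /\ idempotent_complete.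

Definition monic X Y (f : Mor X Y) : Prop :=
  forall W (u v : Mor W X), f \oc u = f \oc v -> u = v.

Definition epic X Y (f : Mor X Y) : Prop :=
  forall Z (u v : Mor Y Z), u \oc f = v \oc f -> u = v.

Definition is_kernel K X Y (i : Mor K X) (f : Mor X Y) : Prop :=
  f \oc i = 0 /\
  forall W (h : Mor W X), f \oc h = 0 -> exists! u : Mor W K, i \oc u = h.

Definition is_cokernel X Y Q (f : Mor X Y) (q : Mor Y Q) : Prop :=
  q \oc f = 0 /\
  forall Z (h : Mor Y Z), h \oc f = 0 -> exists! u : Mor Q Z, u \oc q = h.

Definition abelian_category : Prop :=
  [/\ has_direct_sums,
      forall X Y (f : Mor X Y), exists K (i : Mor K X), is_kernel i f,
      forall X Y (f : Mor X Y), exists Q (q : Mor Y Q), is_cokernel f q,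
      forall X Y (f : Mor X Y), monic f -> exists Z (g : Mor Y Z), is_kernel f g
    & forall X Y (f : Mor X Y), epic f -> exists W (g : Mor W X), is_cokernel g f].

Definition short_exact X Y Z (f : Mor X Y) (g : Mor Y Z) : Prop :=
  is_kernel f g /\ is_cokernel f g.

Definition simple X : Prop :=
  ~ is_zero X /\ forall Y (f : Mor Y X), monic f -> is_zero Y \/ is_iso f.

Definition semisimple_category : Prop :=
  forall X, exists n (S : 'I_n -> Ob C), (forall i, simple (S i)) /\ is_dsum S X.

Inductive finite_length : Ob C -> Prop :=
| finite_length0 X : is_zero X -> finite_length X
| finite_lengthS X Y Z (f : Mor X Y) (g : Mor Y Z) :
    finite_length X -> simple Z -> short_exact f g -> finite_length Y.

(* The isomorphism classes of the objects satisfying P form, through the      *)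
(* class map cl, a basis of the abelian group R.                              *)
Definition classes_basis (P : Ob C -> Prop) (R : zmodType) (cl : Ob C -> R) : Prop :=
  [/\ forall X Y, P X -> P Y -> isomorphic X Y -> cl X = cl Y,
      forall n (X : 'I_n -> Ob C) (a : 'I_n -> int),
        (forall i, P (X i)) -> (forall i j, isomorphic (X i) (X j) -> i = j) ->
        \sum_i cl (X i) *~ a i = 0 -> forall i, a i = 0
    & forall r : R, exists n (X : 'I_n -> Ob C) (a : 'I_n -> int),
        (forall i, P (X i)) /\ r = \sum_i cl (X i) *~ a i].

End LinearCategories.

Section MonoidalCategories.
Variables (k : fieldType) (C : moncat k).
Implicit Types X Y Z : Ob C.

Definition scalar_unit : Prop :=
  bijective (fun a : k => a *: idm (one C)).

(* X' is a left dual of X, equivalently X is a right dual of X'.              *)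
Definition duality X' X (ev : Mor (X' \ox X) (one C)) (coev : Mor (one C) (X \ox X')) :
    Prop :=
  runit X \oc (idm X \om ev) \oc assoc X X' X \oc (coev \om idm X) \oc lunitV X
    = idm X /\
  lunit X' \oc (ev \om idm X') \oc assocV X' X X' \oc (idm X' \om coev) \oc runitV X'
    = idm X'.

Definition rigid : Prop := forall X,
  (exists X' (ev : Mor (X' \ox X) (one C)) (coev : Mor (one C) (X \ox X')),
     duality ev coev) /\
  (exists X' (ev : Mor (X \ox X') (one C)) (coev : Mor (one C) (X' \ox X)),
     duality ev coev).

Fixpoint tens_pow X n : Ob C := if n is m.+1 then tens_pow X m \ox X else one C.

Definition moderate_growth_obj X : Prop :=
  exists n, (\dim {: Mor (tens_pow X n) (tens_pow X n)} < n`!)%N.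

Definition moderate_growth : Prop :=
  forall X, indecomposable X -> moderate_growth_obj X.

Definition tensor_category : Prop :=
  [/\ abelian_category C, rigid, forall X, finite_length X & scalar_unit].

Definition non_negligible X : Prop :=
  indecomposable X /\ exists Y, direct_summand (one C) (Y \ox X).

(* R is the ring K(C), with cl X the class of a non-negligible object X; the  *)
(* values of cl on the other objects are irrelevant.                          *)
Definition is_green_ring (R : pzRingType) (cl : Ob C -> R) : Prop :=
  [/\ classes_basis non_negligible cl,
      cl (one C) = 1
    & forall X Y, non_negligible X -> non_negligible Y ->
      forall n (Z : 'I_n -> Ob C), (forall i, indecomposable (Z i)) ->
        is_dsum Z (X \ox Y) ->
        cl X * cl Y = \sum_(i | `[< non_negligible (Z i) >]) cl (Z i)].

(* R is the Grothendieck ring of a tensor category, with cl X = [X].          *)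
Definition is_grothendieck_ring (R : pzRingType) (cl : Ob C -> R) : Prop :=
  [/\ classes_basis (@simple k C) cl,
      forall X Y Z (f : Mor X Y) (g : Mor Y Z),
        short_exact f g -> cl Y = cl X + cl Z,
      cl (one C) = 1
    & forall X Y, cl (X \ox Y) = cl X * cl Y].

(* I X Y is the subspace of the morphisms X -> Y that belong to the ideal.    *)
Record tensor_ideal := TensorIdeal {
  ideal_mor :> forall X Y, {vspace Mor X Y};
  ideal_compl : forall X Y Z (g : Mor Y Z) (f : Mor X Y),
    f \in ideal_mor X Y -> g \oc f \in ideal_mor X Z;
  ideal_compr : forall X Y Z (g : Mor Y Z) (f : Mor X Y),
    g \in ideal_mor Y Z -> g \oc f \in ideal_mor X Z;
  ideal_tensl : forall X X' Y Y' (f : Mor X X') (g : Mor Y Y'),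
    g \in ideal_mor Y Y' -> f \om g \in ideal_mor (X \ox Y) (X' \ox Y');
  ideal_tensr : forall X X' Y Y' (f : Mor X X') (g : Mor Y Y'),
    f \in ideal_mor X X' -> f \om g \in ideal_mor (X \ox Y) (X' \ox Y')
}.

End MonoidalCategories.

Arguments is_green_ring {k} C {R} cl.
Arguments is_grothendieck_ring {k} C {R} cl.

Section QuantumTrace.
Variables (k : fieldType) (C : bmcat k).
Implicit Types X Y : Ob C.

Definition qtrace X X' (ev : Mor (X' \ox X) (one C)) (coev : Mor (one C) (X \ox X'))
    (f : Mor X X) : Mor (one C) (one C) :=
  ev \oc (idm X' \om f) \oc br X X' \oc coev.

(* The quantum trace does not depend on the choice of the left dual of X, so  *)
(* that the quantification over all left duals is harmless when C is rigid.   *)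
Definition negligible X Y (f : Mor X Y) : Prop :=
  forall X' (ev : Mor (X' \ox X) (one C)) (coev : Mor (one C) (X \ox X')),
    duality ev coev -> forall g : Mor Y X, qtrace ev coev (g \oc f) = 0.

End QuantumTrace.

(* The quotient of C by a tensor ideal has the objects of C, and its          *)
(* structure morphisms are the images of those of C.                          *)

Section QuotientCategory.
Variables (k : fieldType) (C : moncat k) (I : tensor_ideal C).
Implicit Types X Y Z W : Ob C.

Definition qMor X Y : vectType k := quotv (I X Y).
Definition qpi X Y (f : Mor X Y) : qMor X Y := quotv_pi (I X Y) f.
Definition qidm X : qMor X X := qpi (idm X).
Definition qcomp X Y Z (g : qMor Y Z) (f : qMor X Y) : qMor X Z :=
  qpi (repr g \oc repr f).
Definition qtensm X X' Y Y' (f : qMor X X') (g : qMor Y Y') :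
    qMor (X \ox Y) (X' \ox Y') :=
  qpi (repr f \om repr g).

Lemma qpi_linear X Y : linear (@qpi X Y).
Proof. exact: quotv_pi_is_linear. Qed.

Lemma qpi_eq0 X Y (f : Mor X Y) : qpi f = 0 <-> f \in I X Y.
Proof. exact: quotv_eq0. Qed.

Lemma qpiP X Y (q : qMor X Y) : exists f, q = qpi f.
Proof. by exists (repr q); rewrite /qpi quotv_repr. Qed.

Lemma qcompE X Y Z (g : Mor Y Z) (f : Mor X Y) :
  qcomp (qpi g) (qpi f) = qpi (g \oc f).
Proof.
apply/quotv_eq; set g' := repr _; set f' := repr _.
have gI : g' - g \in I Y Z := quotv_repr_pi _ _.
have fI : f' - f \in I X Y := quotv_repr_pi _ _.
rewrite -(subrKA (g \oc f')) memvD //.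
  by rewrite -(zmod_morphism_linear (comp_linl f')) ideal_compr.
by rewrite -(zmod_morphism_linear (comp_linr g)) ideal_compl.
Qed.

Lemma qcomp3E W X Y Z (h : Mor Y Z) (g : Mor X Y) (f : Mor W X) :
  qcomp (qcomp (qpi h) (qpi g)) (qpi f) = qpi (h \oc g \oc f).
Proof. by rewrite (qcompE h g) qcompE. Qed.

Lemma qtensmE X X' Y Y' (f : Mor X X') (g : Mor Y Y') :
  qtensm (qpi f) (qpi g) = qpi (f \om g).
Proof.
apply/quotv_eq; set f' := repr _; set g' := repr _.
have fI : f' - f \in I X X' := quotv_repr_pi _ _.
have gI : g' - g \in I Y Y' := quotv_repr_pi _ _.
rewrite -(subrKA (f \om g')) memvD //.
  by rewrite -(zmod_morphism_linear (tens_linl g')) ideal_tensr.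
by rewrite -(zmod_morphism_linear (tens_linr f)) ideal_tensl.
Qed.

Fact qcomp_linl X Y Z (f : qMor X Y) : linear (fun g : qMor Y Z => qcomp g f).
Proof.
move=> a g h; have [f0 ->] := qpiP f; have [g0 ->] := qpiP g.
by have [h0 ->] := qpiP h; rewrite -qpi_linear !qcompE comp_linl qpi_linear.
Qed.
Fact qcomp_linr X Y Z (g : qMor Y Z) : linear (fun f : qMor X Y => qcomp g f).
Proof.
move=> a f h; have [f0 ->] := qpiP f; have [g0 ->] := qpiP g.
by have [h0 ->] := qpiP h; rewrite -qpi_linear !qcompE comp_linr qpi_linear.
Qed.
Fact qcomp1m X Y (f : qMor X Y) : qcomp (qidm Y) f = f.
Proof. by have [f0 ->] := qpiP f; rewrite qcompE comp1m. Qed.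
Fact qcompm1 X Y (f : qMor X Y) : qcomp f (qidm X) = f.
Proof. by have [f0 ->] := qpiP f; rewrite qcompE compm1. Qed.
Fact qcompA W X Y Z (h : qMor Y Z) (g : qMor X Y) (f : qMor W X) :
  qcomp h (qcomp g f) = qcomp (qcomp h g) f.
Proof.
have [f0 ->] := qpiP f; have [g0 ->] := qpiP g; have [h0 ->] := qpiP h.
by rewrite !qcompE compA.
Qed.

Definition quot_lincat : lincat k :=
  Lincat qcomp_linl qcomp_linr qcomp1m qcompm1 qcompA.

Fact qtens_linl X X' Y Y' (g : qMor Y Y') :
  linear (fun f : qMor X X' => qtensm f g).
Proof.
move=> a f h; have [f0 ->] := qpiP f; have [g0 ->] := qpiP g.
by have [h0 ->] := qpiP h; rewrite -qpi_linear !qtensmE tens_linl qpi_linear.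
Qed.
Fact qtens_linr X X' Y Y' (f : qMor X X') :
  linear (fun g : qMor Y Y' => qtensm f g).
Proof.
move=> a g h; have [f0 ->] := qpiP f; have [g0 ->] := qpiP g.
by have [h0 ->] := qpiP h; rewrite -qpi_linear !qtensmE tens_linr qpi_linear.
Qed.
Fact qtens1 X Y : qtensm (qidm X) (qidm Y) = qidm (X \ox Y).
Proof. by rewrite qtensmE tens1. Qed.
Fact qtens_comp X X' X'' Y Y' Y''
    (f' : qMor X' X'') (f : qMor X X') (g' : qMor Y' Y'') (g : qMor Y Y') :
  qtensm (qcomp f' f) (qcomp g' g) = qcomp (qtensm f' g') (qtensm f g).
Proof.
have [f0 ->] := qpiP f; have [g0 ->] := qpiP g; have [f1 ->] := qpiP f'.
by have [g1 ->] := qpiP g'; rewrite !(qcompE, qtensmE) tens_comp.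
Qed.

Definition qassoc X Y Z := qpi (assoc X Y Z).
Definition qassocV X Y Z := qpi (assocV X Y Z).
Definition qlunit X := qpi (lunit X).
Definition qlunitV X := qpi (lunitV X).
Definition qrunit X := qpi (runit X).
Definition qrunitV X := qpi (runitV X).

Fact qassocK X Y Z : qcomp (qassocV X Y Z) (qassoc X Y Z) = qidm _.
Proof. by rewrite qcompE assocK. Qed.
Fact qassocVK X Y Z : qcomp (qassoc X Y Z) (qassocV X Y Z) = qidm _.
Proof. by rewrite qcompE assocVK. Qed.
Fact qlunitK X : qcomp (qlunitV X) (qlunit X) = qidm _.
Proof. by rewrite qcompE lunitK. Qed.
Fact qlunitVK X : qcomp (qlunit X) (qlunitV X) = qidm _.
Proof. by rewrite qcompE lunitVK. Qed.
Fact qrunitK X : qcomp (qrunitV X) (qrunit X) = qidm _.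
Proof. by rewrite qcompE runitK. Qed.
Fact qrunitVK X : qcomp (qrunit X) (qrunitV X) = qidm _.
Proof. by rewrite qcompE runitVK. Qed.
Fact qassoc_nat X X' Y Y' Z Z' (f : qMor X X') (g : qMor Y Y') (h : qMor Z Z') :
  qcomp (qassoc X' Y' Z') (qtensm (qtensm f g) h) =
  qcomp (qtensm f (qtensm g h)) (qassoc X Y Z).
Proof.
have [f0 ->] := qpiP f; have [g0 ->] := qpiP g; have [h0 ->] := qpiP h.
by rewrite !(qcompE, qtensmE) assoc_nat.
Qed.
Fact qlunit_nat X X' (f : qMor X X') :
  qcomp (qlunit X') (qtensm (qidm (one C)) f) = qcomp f (qlunit X).
Proof. by have [f0 ->] := qpiP f; rewrite /qidm qtensmE !qcompE lunit_nat. Qed.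
Fact qrunit_nat X X' (f : qMor X X') :
  qcomp (qrunit X') (qtensm f (qidm (one C))) = qcomp f (qrunit X).
Proof. by have [f0 ->] := qpiP f; rewrite /qidm qtensmE !qcompE runit_nat. Qed.
Fact qpentagon W X Y Z :
  qcomp (qassoc W X (Y \ox Z)) (qassoc (W \ox X) Y Z) =
  qcomp (qcomp (qtensm (qidm W) (qassoc X Y Z)) (qassoc W (X \ox Y) Z))
    (qtensm (qassoc W X Y) (qidm Z)).
Proof. by rewrite /qidm !qtensmE !qcomp3E ?qcompE pentagon. Qed.
Fact qtriangle X Y :
  qcomp (qtensm (qidm X) (qlunit Y)) (qassoc X (one C) Y) =
  qtensm (qrunit X) (qidm Y).
Proof. by rewrite /qidm !qtensmE !qcompE triangle. Qed.

Definition quot_moncat : moncat k :=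
  @Moncat k quot_lincat (@tens k C) (one C) qtensm
    qassoc qassocV qlunit qlunitV qrunit qrunitV
    qtens_linl qtens_linr qtens1 qtens_comp qassocK qassocVK
    qlunitK qlunitVK qrunitK qrunitVK qassoc_nat qlunit_nat qrunit_nat
    qpentagon qtriangle.

End QuotientCategory.

Section QuotientBraided.
Variables (k : fieldType) (C : bmcat k) (I : tensor_ideal C).
Implicit Types X Y Z : Ob C.

Definition qbr X Y : qMor I (X \ox Y) (Y \ox X) := qpi I (br X Y).
Definition qbrV X Y : qMor I (Y \ox X) (X \ox Y) := qpi I (brV X Y).

Fact qbrK X Y : qcomp (qbrV X Y) (qbr X Y) = qidm I _.
Proof. by rewrite qcompE brK. Qed.
Fact qbrVK X Y : qcomp (qbr X Y) (qbrV X Y) = qidm I _.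
Proof. by rewrite qcompE brVK. Qed.
Fact qbr_nat X X' Y Y' (f : qMor I X X') (g : qMor I Y Y') :
  qcomp (qbr X' Y') (qtensm f g) = qcomp (qtensm g f) (qbr X Y).
Proof.
have [f0 ->] := qpiP f; have [g0 ->] := qpiP g.
by rewrite !(qcompE, qtensmE) br_nat.
Qed.
Fact qhexagon1 X Y Z :
  qcomp (qcomp (qassoc I Y Z X) (qbr X (Y \ox Z))) (qassoc I X Y Z) =
  qcomp (qcomp (qtensm (qidm I Y) (qbr X Z)) (qassoc I Y X Z))
    (qtensm (qbr X Y) (qidm I Z)).
Proof. by rewrite /qidm !qtensmE !qcomp3E ?qcompE hexagon1. Qed.
Fact qhexagon2 X Y Z :
  qcomp (qcomp (qassocV I Z X Y) (qbr (X \ox Y) Z)) (qassocV I X Y Z) =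
  qcomp (qcomp (qtensm (qbr X Z) (qidm I Y)) (qassocV I X Z Y))
    (qtensm (qidm I X) (qbr Y Z)).
Proof. by rewrite /qidm !qtensmE !qcomp3E ?qcompE hexagon2. Qed.

Definition quot_bmcat : bmcat k :=
  @Bmcat k (quot_moncat I) qbr qbrV qbrK qbrVK qbr_nat qhexagon1 qhexagon2.

End QuotientBraided.

(* Main.v *)
(* The negligible morphisms are those f : X -> Y whose pairing b (f \om 1) a  *)
(* vanishes for all a : 1 -> X \ox U and b : Y \ox U -> 1; so they form a    *)
(* tensor ideal I.  Everything rests on the fact that nilpotent endomorphisms *)
(* g of an indecomposable object X lie in I; one reduces to showing that      *)
(* Tr g = 0 when g^2 is in I.  Since dim End(X^n) < n!, the braidings b_s     *)
(* lifting the permutations s of the n strands of X^n satisfy a linear        *)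
(* relation.  Multiply it by g^n and some b_u^-1 and close up by the iterated *)
(* partial trace: for s <> u two copies of g can be slid next to each other   *)
(* on one strand, so that term vanishes, while the term s = u gives (Tr g)^n. *)
(* By the Fitting lemma, modulo I the indecomposable objects of C then obey   *)
(* Schur's lemma, and the quotient is semisimple.  Its simple objects are the *)
(* non-negligible indecomposables of C, and the Grothendieck ring is realised *)
(* inside the functions Ob C -> Z by X |-> (Z |-> dim Hom(Z, X)); rigidity    *)
(* expresses the product through either factor, which makes it well defined.  *)

From HB Require Import structures.
From mathcomp Require Import all_boot all_order all_algebra all_fingroup.
From mathcomp Require Import boolp functions zify.
Require Import Defs.

Set Implicit Arguments.
Unset Strict Implicit.
Unset Printing Implicit Defensive.

Import GRing.Theory.
Local Open Scope ring_scope.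
Local Open Scope cat_scope.

(** * Linear categories *)

(** Everything follows from a dichotomy: a morphism between non-negligible indecomposable objects is
    either negligible or already invertible in [C]. [null_pairing] expresses negligibility without
    choosing duals, so that [null_pairing_ideal] rests on the braiding alone; [negligibleP]
    identifies it with the trace condition, because every pairing with [X \ox U] factors through the
    dual of [X].

    By [nilp_or_iso] an endomorphism of an indecomposable object is nilpotent or invertible. If
    [f : S -> T] is not negligible, some [g \oc f] has nonzero trace. Moderate growth forces
    endomorphisms with negligible square to have trace zero ([trace_square_zero]), hence nilpotent
    ones to be negligible ([nilp_ideal]); so [g \oc f] and [f \oc g] are invertible, and so is [f]
    ([not_ideal_iso]).

    In the quotient the negligible summands become zero, so every object is a sum of non-negligible
    ones, between which nonzero morphisms are invertible. From this alone every morphism [f]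
    satisfies [f \oc g \oc f = f] for some [g] ([regular]), which yields split idempotents, kernels,
    cokernels and semisimplicity with no lifting of idempotents to [C].

    By [quot_isomorphic_lift] non-negligible objects isomorphic in the quotient are isomorphic in
    [C]. The Green ring and the Grothendieck ring thus have the same basis and the same product;
    [ring_of_classes] builds this ring and [green_ring_exists] verifies both descriptions. *)

Lemma vspace_of_pred (k : fieldType) (V : vectType k) (P : V -> Prop) :
  P 0 -> (forall a u v, P u -> P v -> P (a *: u + v)) ->
  exists U : {vspace V}, forall v, v \in U <-> P v.
Proof.
move=> P0 PD.
(* Take a subspace of largest dimension inside [P]: adjoining any vector of [P] cannot enlarge
   it. *)
pose Q n := `[< exists U : {vspace V}, \dim U = n /\ forall v, v \in U -> P v
  >].
have Q0 : exists n, Q n.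
  exists 0%N; apply/asboolP; exists 0%VS; split=> [|v]; first exact: dimv0.
  by rewrite memv0 => /eqP->.
have Qb n : Q n -> (n <= \dim {: V})%N.
  by move=> /asboolP[U [<- _]]; exact/dimvS/subvf.
have [n /asboolP[U [dimU UP]] Umax] := ex_maxnP Q0 Qb.
exists U => v; split=> [/UP//|Pv].
have /Umax: Q (\dim (U + <[v]>)).
  apply/asboolP; exists (U + <[v]>)%VS; split=> // w.
  by move=> /memv_addP[u /UP Pu [_ /vlineP[a ->] ->]]; rewrite addrC; exact: PD.
rewrite -dimU => le_d.
have /eqP-> : U == (U + <[v]>)%VS by rewrite eqEdim addvSl.
by rewrite (subvP (addvSr _ _)) // memv_line.
Qed.

Lemma big_sub_val (V : nmodType) (J : finType) (P : pred J) (F : J -> V) :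
  \sum_(j | P j) F j = \sum_(u : {j | P j}) F (val u).
Proof.
rewrite (reindex_omap (val : {j | P j} -> J) insub) /=; last first.
  by move=> j Pj; rewrite insubT.
by apply: eq_bigl => -[j Pj] /=; rewrite Pj insubT /= eqxx.
Qed.

Section LinearCategory.
Variables (k : fieldType) (C : lincat k).
Implicit Types X Y Z W S : Ob C.

(** The flipped composition is named so that a linear structure can be attached to it. *)
Definition precomp X Y Z (f : Mor X Y) (g : Mor Y Z) : Mor X Z := g \oc f.
HB.instance Definition _ X Y Z (f : Mor X Y) :=
  GRing.isLinear.Build k (Mor Y Z) (Mor X Z) _ (precomp f) (comp_linl f).
HB.instance Definition _ X Y Z (g : Mor Y Z) :=
  GRing.isLinear.Build k (Mor X Y) (Mor X Z) _ (@comp k C X Y Z g) (comp_linr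
    g).

Lemma compDl X Y Z (g h : Mor Y Z) (f : Mor X Y) :
  (g + h) \oc f = g \oc f + h \oc f.
Proof. exact: (linearD (precomp f)). Qed.
Lemma compDr X Y Z (g : Mor Y Z) (f h : Mor X Y) :
  g \oc (f + h) = g \oc f + g \oc h.
Proof. exact: linearD. Qed.
Lemma compBl X Y Z (g h : Mor Y Z) (f : Mor X Y) :
  (g - h) \oc f = g \oc f - h \oc f.
Proof. exact: (linearB (precomp f)). Qed.
Lemma compBr X Y Z (g : Mor Y Z) (f h : Mor X Y) :
  g \oc (f - h) = g \oc f - g \oc h.
Proof. exact: linearB. Qed.
Lemma compZl X Y Z a (g : Mor Y Z) (f : Mor X Y) : (a *: g) \oc f = a *: (g \oc
  f).
Proof. exact: (linearZZ (precomp f)). Qed.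
Lemma compZr X Y Z a (g : Mor Y Z) (f : Mor X Y) : g \oc (a *: f) = a *: (g \oc
  f).
Proof. exact: linearZZ. Qed.
Lemma comp0l X Y Z (f : Mor X Y) : (0 : Mor Y Z) \oc f = 0.
Proof. exact: (linear0 (precomp f)). Qed.
Lemma comp0r X Y Z (g : Mor Y Z) : g \oc (0 : Mor X Y) = 0.
Proof. exact: linear0. Qed.
Lemma comp_suml X Y Z (J : Type) (s : seq J) (P : pred J) (F : J -> Mor Y Z)
    (f : Mor X Y) :
  (\sum_(j <- s | P j) F j) \oc f = \sum_(j <- s | P j) (F j \oc f).
Proof. exact: (linear_sum (precomp f)). Qed.
Lemma comp_sumr X Y Z (J : Type) (s : seq J) (P : pred J) (F : J -> Mor X Y)
    (g : Mor Y Z) :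
  g \oc (\sum_(j <- s | P j) F j) = \sum_(j <- s | P j) (g \oc F j).
Proof. exact: linear_sum. Qed.

Lemma comp_cancell X Y Z (g : Mor Y Z) (f : Mor Z Y) (h : Mor X Z) :
  g \oc f = idm Z -> g \oc (f \oc h) = h.
Proof. by move=> gf; rewrite compA gf comp1m. Qed.

Lemma is_zeroP X : is_zero X <-> idm X = 0.
Proof.
split=> [Xz|id0]; first by have [/(_ (idm X))] := Xz X.
by move=> Y; split=> f; [rewrite -(compm1 f)|rewrite -(comp1m f)];
  rewrite id0 ?comp0r ?comp0l.
Qed.

Lemma iso_isomorphic X Y (f : Mor X Y) (g : Mor Y X) :
  g \oc f = idm X -> f \oc g = idm Y -> isomorphic X Y.
Proof. by move=> gf fg; exists f, g. Qed.

Lemma isomorphic_refl X : isomorphic X X.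
Proof. by apply: (@iso_isomorphic X X (idm X) (idm X)); rewrite comp1m. Qed.

Lemma isomorphic_sym X Y : isomorphic X Y -> isomorphic Y X.
Proof. by move=> [f [g [gf fg]]]; exists g, f. Qed.

(** The map [g] only witnesses injectivity of [f], so its linearity is not asked for. *)
Lemma dim_Mor_le X Y X' Y' (f : Mor X Y -> Mor X' Y') (g : Mor X' Y' -> Mor X
  Y) :
  linear f -> cancel f g -> (\dim {: Mor X Y} <= \dim {: Mor X' Y'})%N.
Proof.
move=> f_lin fK; pose F := GRing.isLinear.Build k _ _ _ f f_lin.
pose f' : {linear Mor X Y -> Mor X' Y'} := HB.pack f F.
rewrite -(limg_dim_eq (f := linfun f')) ?dimvS ?subvf //.
apply/eqP; rewrite capfv; apply/lker0P => u v.
by rewrite !lfunE /= => /(can_inj fK).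
Qed.

Lemma dim_Mor_iso X X' Y Y' :
  isomorphic X X' -> isomorphic Y Y' -> \dim {: Mor X Y} = \dim {: Mor X' Y'}.
Proof.
have le (A A' B B' : Ob C) : isomorphic A A' -> isomorphic B B' ->
    (\dim {: Mor A B} <= \dim {: Mor A' B'})%N.
  move=> [f [f' [f'f ff']]] [g [g' [g'g gg']]].
  refine (@dim_Mor_le A B A' B' (fun h => g \oc h \oc f') (fun h => g' \oc h
    \oc f) _ _).
    by move=> a u v; rewrite comp_linr comp_linl.
  by move=> h; rewrite !compA g'g comp1m -compA f'f compm1.
by move=> iX iY; apply/eqP; rewrite eqn_leq !le //; apply: isomorphic_sym.
Qed.

Lemma is_dsum_reindex (J K : finType) (h : K -> J) (Z : J -> Ob C) S :
  bijective h -> is_dsum Z S -> is_dsum (Z \o h) S.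
Proof.
move=> bij_h [i [p [p_i1 p_i0 sum_ip]]].
exists (fun j => i (h j)), (fun j => p (h j)); split=> [j|j l neq|].
- exact: p_i1.
- by apply: p_i0; rewrite (bij_eq bij_h).
by rewrite -sum_ip [RHS](reindex h) //; exact: onW_bij.
Qed.

Lemma is_dsum_ord (J : finType) (Z : J -> Ob C) S :
  is_dsum Z S -> is_dsum (fun j : 'I_#|J| => Z (enum_val j)) S.
Proof. exact/is_dsum_reindex/enum_val_bij. Qed.

Lemma is_dsum_support (J : finType) (P : pred J) (Z : J -> Ob C) S :
  (forall j, ~~ P j -> is_zero (Z j)) -> is_dsum Z S ->
  is_dsum (fun j : {j | P j} => Z (val j)) S.
Proof.
move=> PZ [i [p [p_i1 p_i0 sum_ip]]].
exists (fun j => i (val j)), (fun j => p (val j)); split=> [j|j l neq|].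
- exact: p_i1.
- exact: p_i0.
rewrite -sum_ip [RHS](bigID P) /= [X in _ = _ + X]big1 ?addr0; last first.
  by move=> j /PZ/is_zeroP Zj; rewrite -(compm1 (i j)) Zj comp0r comp0l.
by rewrite [RHS]big_sub_val.
Qed.

Lemma is_dsum_sig (J : finType) (K : J -> finType) (Z : J -> Ob C)
    (T : forall j, K j -> Ob C) S :
  is_dsum Z S -> (forall j, is_dsum (T j) (Z j)) ->
  is_dsum (fun u : {j : J & K j} => T (tag u) (tagged u)) S.
Proof.
move=> [i [p [p_i1 p_i0 sum_ip]]] TZ.
pose a j := projT1 (cid (TZ j)); have Ha j := projT2 (cid (TZ j)).
pose b j := projT1 (cid (Ha j)); have Hab j := projT2 (cid (Ha j)).
rewrite -/a in Ha Hab b.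
exists (fun u => i (tag u) \oc a (tag u) (tagged u)).
exists (fun u => b (tag u) (tagged u) \oc p (tag u)).
split=> [[j l]|[j l] [j' l'] neq|] /=.
- by have [ba1 _ _] := Hab j; rewrite -compA (comp_cancell _ (p_i1 j)) ba1.
- have [ee|nee] := eqVneq j j'; last first.
    by rewrite -compA (compA (p j)) p_i0 // comp0l comp0r.
  subst j'; have [_ ba0 _] := Hab j; rewrite -compA (comp_cancell _ (p_i1 j)).
  by apply: ba0; apply: contraNneq neq => ->.
rewrite -sum_ip -(@sig_big_dep _ _ _ J K xpredT (fun _ => xpredT)
  (fun j l => i j \oc a j l \oc (b j l \oc p j))) /=.
apply: eq_bigr => j _; have [_ _ ab1] := Hab j.
rewrite -[in RHS](comp1m (p j)) -ab1 comp_suml comp_sumr.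
by apply: eq_bigr => l _; rewrite !compA.
Qed.

Lemma is_dsum1 X : is_dsum (fun _ : unit => X) X.
Proof.
exists (fun _ => idm X), (fun _ => idm X).
split=> [_|[] []|]; rewrite ?comp1m //.
by rewrite sumr_const card_unit.
Qed.

Lemma is_dsum_zero X (Z : void -> Ob C) : is_zero X -> is_dsum Z X.
Proof.
move=> /is_zeroP X0; exists (fun j : void => match j with end), (fun j : void
  => match j with end).
by split=> [[]|[]|]; rewrite X0 big1 // => -[].
Qed.

Lemma is_dsum2P X Y S : is_dsum2 X Y S <->
  exists (i : Mor X S) (p : Mor S X) (j : Mor Y S) (q : Mor S Y),
  [/\ p \oc i = idm X, q \oc j = idm Y, p \oc j = 0, q \oc i = 0
    & i \oc p + j \oc q = idm S].
Proof.
split=> [[i [p [pi1 pi0 sum_ip]]]|[i [p [j [q [pi1 qj1 pj0 qi0 sum]]]]]].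
  exists (i true), (p true), (i false), (p false).
  split; [exact: (pi1 true)|exact: (pi1 false)|exact: (pi0 true false isT)
    |exact: (pi0 false true isT)|].
  by rewrite -sum_ip big_bool.
exists (fun b => if b as b return Mor (if b then X else Y) S then i else j).
exists (fun b => if b as b return Mor S (if b then X else Y) then p else q).
by split=> [[]|[] []|]; rewrite ?big_bool.
Qed.

Lemma is_dsum2_sym X Y S : is_dsum2 X Y S -> is_dsum2 Y X S.
Proof.
move=> /is_dsum2P[i [p [j [q [pi1 qj1 pj0 qi0 sum]]]]].
by apply/is_dsum2P; exists j, q, i, p; split=> //; rewrite addrC.
Qed.

(** The complement is the image of the idempotent [idm Y - i \oc p]. *)
Lemma idempotent_complement X Y (i : Mor X Y) (p : Mor Y X) :
  idempotent_complete C -> p \oc i = idm X ->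
  exists Z (j : Mor Z Y) (q : Mor Y Z),
  [/\ q \oc j = idm Z, p \oc j = 0, q \oc i = 0 & i \oc p + j \oc q = idm Y].
Proof.
move=> split_idem pi1; pose e := idm Y - i \oc p.
have e_idem : e \oc e = e.
  rewrite {1}/e compBl comp1m /e compBr compm1 -compA (comp_cancell _ pi1).
  by rewrite subrr subr0.
have [Z [q [j [qj1 jq]]]] := split_idem _ _ e_idem.
exists Z, j, q; split=> //.
- rewrite -(compm1 j) -qj1 (compA j) jq compA /e compBr compm1 compA pi1 comp1m.
  by rewrite subrr comp0l.
- rewrite -(comp1m q) -qj1 -(compA q) jq -compA /e compBl comp1m -compA pi1.
  by rewrite compm1 subrr comp0r.
by rewrite jq /e addrC subrK.
Qed.

(* Splitting off a nonzero summand removes its identity from End(S), so the   *)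
(* endomorphisms of the other summand form a proper subspace.                 *)
Lemma dim_End_summand X Y S : is_dsum2 X Y S -> ~ is_zero Y ->
  (\dim {: Mor X X} < \dim {: Mor S S})%N.
Proof.
move=> /is_dsum2P[i [p [j [q [pi1 qj1 pj0 qi0 sum]]]]] /is_zeroP Y0.
rewrite ltnNge; apply: contra_notN Y0 => le_dim.
pose f := (linfun (@comp k C X X S i) : 'Hom(Mor X X, Mor X S)).
pose g := (linfun (precomp p) : 'Hom(Mor X S, Mor S S)).
have fE h : f h = i \oc h by rewrite lfunE.
have gE h : g h = h \oc p by rewrite lfunE.
have inj : lker (g \o f)%VF == 0%VS.
  apply/lker0P => u v; rewrite !comp_lfunE !gE !fE.
  move/(congr1 (fun h => p \oc h \oc i)).
  by rewrite -!compA pi1 !compm1 !(comp_cancell _ pi1).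
have /eqP full : limg (g \o f)%VF == fullv.
  by rewrite eqEdim subvf limg_dim_eq // (eqP inj) capv0.
have : idm S \in limg (g \o f)%VF by rewrite full memvf.
move=> /memv_imgP[h _]; rewrite comp_lfunE gE fE => id_eq.
by rewrite -qj1 -(comp1m j) id_eq !compA qi0 !comp0l.
Qed.

(** Induction on [\dim {: Mor X X}], which drops strictly for both parts of a proper decomposition.
    A zero object is the empty sum. *)
Lemma indecomposable_dsum X : exists (J : finType) (Z : J -> Ob C),
  (forall j, indecomposable (Z j)) /\ is_dsum Z X.
Proof.
have [n] := ubnP (\dim {: Mor X X}); elim: n X => // n IHn X le_n.
have [X0|X0] := pselect (is_zero X).
  by exists void, (fun _ => X); split=> [[]|]; exact: is_dsum_zero.
have [Xind|Xdec] := pselect (indecomposable X).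
  by exists unit, (fun _ => X); split=> [//|]; exact: is_dsum1.
have [Y [Z [XYZ Y0 Z0]]] : exists Y Z,
    [/\ is_dsum2 Y Z X, ~ is_zero Y & ~ is_zero Z].
  apply: contrapT => noYZ; apply: Xdec; split=> // Y Z XYZ.
  have [?|Y0] := pselect (is_zero Y); [by left|right].
  by apply: contrapT => Z0; apply: noYZ; exists Y, Z.
have ltY : (\dim {: Mor Y Y} < n)%N.
  by rewrite -ltnS (leq_trans _ le_n) // ltnS (dim_End_summand XYZ).
have ltZ : (\dim {: Mor Z Z} < n)%N.
  by rewrite -ltnS (leq_trans _ le_n) // ltnS (dim_End_summand (is_dsum2_sym
    XYZ)).
have [J [T [indT TY]]] := IHn _ ltY; have [K [U [indU UZ]]] := IHn _ ltZ.
pose L (b : bool) : finType := if b then J else K.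
pose V b : L b -> Ob C :=
  if b as b return (if b then J else K : finType) -> Ob C then T else U.
exists {b : bool & L b}, (fun u => V (tag u) (tagged u)).
by split=> [[[] l]|]; [exact: indT|exact: indU|apply: (is_dsum_sig XYZ) => -[]].
Qed.

(** [Mor W S] is the direct sum of the images of the spaces [Mor W (Z j)] under composition with
    [i j]. *)
Lemma dim_Mor_dsum (J : finType) (Z : J -> Ob C) S W : is_dsum Z S ->
  \dim {: Mor W S} = (\sum_j \dim {: Mor W (Z j)})%N.
Proof.
move=> [i [p [pi1 pi0 sum]]].
pose f j := (linfun (@comp k C W (Z j) S (i j)) : 'Hom(Mor W (Z j), Mor W S)).
have fE j h : f j h = i j \oc h by rewrite lfunE.
have dx : directv (\sum_j limg (f j)).
  apply/directv_sum_independent => us us_im us0 j _.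
  have us_eq l : us l = i l \oc (p l \oc us l).
    have /memv_imgP[h _ ->] := us_im l isT.
    by rewrite fE (comp_cancell _ (pi1 l)).
  have := congr1 (comp (p j)) us0.
  rewrite comp_sumr comp0r (bigD1 j) //= big1 ?addr0 => [pj0|l neq].
    by rewrite us_eq pj0 comp0r.
  by rewrite us_eq compA pi0 ?comp0l // eq_sym.
transitivity (\dim (\sum_j limg (f j))); last first.
  rewrite (directvP dx); apply: eq_bigr => j _ /=.
  apply: limg_dim_eq; apply/eqP; rewrite capfv; apply/lker0P => u v.
  rewrite !fE => /(congr1 (comp (p j))).
  by rewrite !(comp_cancell _ (pi1 j)).
congr (\dim _); apply/eqP; rewrite eqEsubv subvf andbT; apply/subvP => h _.
rewrite -(comp1m h) -sum comp_suml memv_sumr // => j _.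
by rewrite -compA -fE memv_img ?memvf.
Qed.

(** * Powers of an endomorphism and Fitting's lemma *)

Definition endpow X (f : Mor X X) n : Mor X X := iter n (comp f) (idm X).

Definition nilp X (f : Mor X X) : Prop := exists n, endpow f n = 0.

Lemma endpowS X (f : Mor X X) n : endpow f n.+1 = f \oc endpow f n.
Proof. by []. Qed.

Lemma endpowD X (f : Mor X X) m n : endpow f (m + n) = endpow f m \oc endpow f
  n.
Proof. by elim: m => [|m IH]; rewrite ?comp1m // addSn !endpowS IH compA. Qed.

Lemma endpowSr X (f : Mor X X) n : endpow f n.+1 = endpow f n \oc f.
Proof. by rewrite -addn1 endpowD /= compm1. Qed.

(* Fitting's lemma: if f^m generates the same left and the same right ideal   *)
(* as f^2m, then f^m = f^2m b = c f^2m and f^m b = c f^m is idempotent.       *)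
Lemma nilp_or_iso X (f : Mor X X) :
  (forall e : Mor X X, e \oc e = e -> e = 0 \/ e = idm X) -> nilp f \/ is_iso f.
Proof.
move=> idem01; pose fp m := endpow f m.+1.
pose l m := limg (linfun (precomp (fp m)) : 'Hom(Mor X X, Mor X X)).
pose r m := limg (linfun (@comp k C X X X (fp m)) : 'Hom(Mor X X, Mor X X)).
have lP m h : reflect (exists g, h = g \oc fp m) (h \in l m).
  apply: (iffP memv_imgP) => [[g _ ->]|[g ->]]; exists g; rewrite ?lfunE ?memvf
    //.
have rP m h : reflect (exists g, h = fp m \oc g) (h \in r m).
  apply: (iffP memv_imgP) => [[g _ ->]|[g ->]]; exists g; rewrite ?lfunE ?memvf
    //.
pose d m := (\dim (l m) + \dim (r m))%N.
have [m _ dmin] : exists2 m, True & forall n, (d m <= d n)%N.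
  have ex : exists n, `[< exists m, d m = n >] by exists (d 0%N);
    apply/asboolP; exists 0%N.
  case: (ex_minnP ex) => n /asboolP[m <-] nmin; exists m => // j.
  by apply: nmin; apply/asboolP; exists j.
have fp2 : fp (m + m.+1)%N = fp m \oc fp m by rewrite /fp -addSn endpowD.
have sl : (l (m + m.+1)%N <= l m)%VS.
  apply/subvP => h /lP[g ->]; apply/lP; exists (g \oc fp m).
  by rewrite fp2 compA.
have sr : (r (m + m.+1)%N <= r m)%VS.
  apply/subvP => h /rP[g ->]; apply/rP; exists (fp m \oc g).
  by rewrite fp2 compA.
have [dl dr] : (\dim (l m) <= \dim (l (m + m.+1)) /\ \dim (r m) <= \dim (r (m +
  m.+1)))%N.
  have := dmin (m + m.+1)%N; have := dimvS sl; have := dimvS sr; rewrite /d.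
  by move: (\dim _) (\dim _) (\dim _) (\dim _) => ????; lia.
have [c fc] : exists c, fp m = c \oc (fp m \oc fp m).
  rewrite -fp2; apply/lP; rewrite (_ : l _ = l m).
    by apply/lP; exists (idm X); rewrite comp1m.
  by apply/eqP; rewrite eqEdim sl.
have [b fb] : exists b, fp m = fp m \oc fp m \oc b.
  rewrite -fp2; apply/rP; rewrite (_ : r _ = r m).
    by apply/rP; exists (idm X); rewrite compm1.
  by apply/eqP; rewrite eqEdim sr.
have e_eq : fp m \oc b = c \oc fp m.
  by rewrite {1}fc -(compA c) -fb.
have e_idem : fp m \oc b \oc (fp m \oc b) = fp m \oc b.
  by rewrite {1}e_eq -(compA c) (compA (fp m)) -fb e_eq.
have [e0|e1] := idem01 _ e_idem.
  by left; exists m.+1; rewrite -/(fp m) fc compA -e_eq e0 comp0l.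
right; have fb1 : f \oc (endpow f m \oc b) = idm X by rewrite compA -endpowS.
have cf1 : c \oc endpow f m \oc f = idm X by rewrite -compA -endpowSr -e_eq.
have LR : c \oc endpow f m = endpow f m \oc b.
  by rewrite -(compm1 (c \oc _)) -fb1 (compA _ f) cf1 comp1m.
by exists (c \oc endpow f m); split=> //; rewrite LR.
Qed.

(** The images of [e] and of [idm X - e] are complementary summands, so one of them is zero. *)
Lemma indecomposable_idem X (e : Mor X X) : idempotent_complete C ->
  indecomposable X -> e \oc e = e -> e = 0 \/ e = idm X.
Proof.
move=> split_idem [_ Xind] ee.
have [Y [p [i [pi1 ip]]]] := split_idem _ _ ee.
have [Z [j [q [qj1 pj0 qi0 sum]]]] := idempotent_complement split_idem pi1.
have XYZ : is_dsum2 Y Z X by apply/is_dsum2P; exists i, p, j, q.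
have [/is_zeroP Y0|/is_zeroP Z0] := Xind _ _ XYZ; [left|right].
  by rewrite -ip -(compm1 i) Y0 comp0r comp0l.
by rewrite -ip -sum -(compm1 j) Z0 comp0r comp0l addr0.
Qed.

End LinearCategory.

(** * Semisimplicity from Schur's lemma *)

Section DirectSums.
Variables (k : fieldType) (C : lincat k).
Hypothesis C_dsum : has_direct_sums C.
Implicit Types X Y Z W S : Ob C.

Lemma dsum_fin (J : finType) (Z : J -> Ob C) : exists S, is_dsum Z S.
Proof.
have [S ZS] := C_dsum (fun j : 'I_#|J| => Z (enum_val j)); exists S.
have := is_dsum_reindex (@enum_rank_bij J) ZS.
by rewrite (_ : _ \o _ = Z) //; apply/funext => j /=; rewrite enum_rankK.
Qed.

Lemma short_exact_summand X Y S (i : Mor X S) (p : Mor S X) (j : Mor Y S)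
    (q : Mor S Y) :
  p \oc i = idm X -> q \oc j = idm Y -> q \oc i = 0 -> i \oc p + j \oc q = idm
    S ->
  short_exact i q.
Proof.
move=> pi1 qj1 qi0 sum; split; split=> // W h; [move=> qh0|move=> hi0].
  exists (p \oc h); split=> [|u <-]; last by rewrite comp_cancell.
  by rewrite -[RHS](comp1m h) -sum compDl -!compA qh0 comp0r addr0.
exists (h \oc j); split=> [|u <-]; last by rewrite -compA qj1 compm1.
by rewrite -[RHS](compm1 h) -sum compDr !compA hi0 comp0l add0r.
Qed.

End DirectSums.

(** * Abelian and semisimple structure from a class [P] of objects obeying Schur's lemma *)

Section SemisimpleCategory.
Variables (k : fieldType) (C : lincat k) (P : Ob C -> Prop).
Hypothesis C_dsum : has_direct_sums C.
Hypothesis P_neq0 : forall S, P S -> ~ is_zero S.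
Hypothesis P_schur : forall S T (f : Mor S T), P S -> P T -> f <> 0 -> is_iso f.
Hypothesis P_dsum : forall X, exists (J : finType) (Z : J -> Ob C),
  (forall j, P (Z j)) /\ is_dsum Z X.
Implicit Types X Y Z W S : Ob C.

(** Some component [p j \oc u] is nonzero, hence invertible; its inverse after [p j] retracts
    [u]. *)
Lemma P_coretract X S (u : Mor S X) : P S -> u <> 0 ->
  exists v : Mor X S, v \oc u = idm S.
Proof.
move=> PS u0; have [J [T [PT [i [p [pi1 pi0 sum]]]]]] := P_dsum X.
have [j pju] : exists j, p j \oc u <> 0.
  apply: contrapT => all0; apply: u0.
  rewrite -(comp1m u) -sum comp_suml big1 // => j _; rewrite -compA.
  have [->|ne] := pselect (p j \oc u = 0); first by rewrite comp0r.
  by case: all0; exists j.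
have [a [ap pa]] := P_schur PS (PT j) pju.
by exists (a \oc p j); rewrite -compA.
Qed.

(* If f u <> 0 for the inclusion u of a summand, let v f u = 1 and g := u v.  *)
(* Then f - f g f kills more summands than f, and f is regular if f - f g f   *)
(* is.                                                                        *)
Lemma regular X Y (f : Mor X Y) : exists g : Mor Y X, f \oc g \oc f = f.
Proof.
have [J [T [PT [i [p [pi1 pi0 sum]]]]]] := P_dsum X.
pose d (f : Mor X Y) := #|[pred j | f \oc i j != 0]|.
have [n] := ubnP (d f); elim: n f => // n IHn f le_n.
have [f0|/eqP f0] := eqVneq f 0; first by exists 0; rewrite f0 !comp0l.
have [j fj] : exists j, f \oc i j <> 0.
  apply: contrapT => all0; apply: f0.
  rewrite -(compm1 f) -sum comp_sumr big1 // => j _; rewrite compA.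
  have [->|ne] := pselect (f \oc i j = 0); first by rewrite comp0l.
  by case: all0; exists j.
have [v vfi] := P_coretract (PT j) fj.
pose g := i j \oc v; pose f' := f - f \oc g \oc f.
have f'i l : f \oc i l = 0 -> f' \oc i l = 0.
  by move=> fl0; rewrite compBl -compA fl0 comp0r subr0.
have f'j : f' \oc i j = 0.
  by rewrite compBl -!compA vfi compm1 subrr.
have [|h f'hf'] := IHn f'.
  rewrite -ltnS (leq_trans _ le_n) // ltnS; apply: proper_card.
  apply/properP; split; first by apply/subsetP=> l; rewrite !inE;
    apply/contraNN => /eqP/f'i->.
  by exists j; rewrite !inE ?f'j ?eqxx //; apply/eqP.
clearbody g; have f'l : f' = (idm Y - f \oc g) \oc f by rewrite compBl comp1m.
have f'r : f' = f \oc (idm X - g \oc f) by rewrite compBr compm1 compA.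
exists (g + (idm X - g \oc f) \oc h \oc (idm Y - f \oc g)).
rewrite compDr compDl !compA -f'r -(compA _ (idm Y - _) f) -f'l f'hf' /f'.
by rewrite addrC subrK.
Qed.

(** Summands in [P] are peeled off the image of [e] one at a time, by induction on the number of
    summands of [X] on which [e] is nonzero. *)
Lemma split_idempotents : idempotent_complete C.
Proof.
move=> X e ee; have [J [T [PT [i [p [pi1 pi0 sum]]]]]] := P_dsum X.
pose d (f : Mor X X) := #|[pred j | f \oc i j != 0]|.
have [n] := ubnP (d e); elim: n e ee => // n IHn e ee le_n.
have [e0|/eqP e0] := eqVneq e 0.
  (* The empty direct sum is a zero object, through which the idempotent [0] splits. *)
  have [Z [a [b [_ _]]]] := dsum_fin C_dsum (fun j : void => X).
  rewrite big_pred0 => [idZ|[]//]; exists Z, 0, 0.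
  by rewrite !comp0l -idZ e0.
have [j ej] : exists j, e \oc i j <> 0.
  apply: contrapT => all0; apply: e0.
  rewrite -(compm1 e) -sum comp_sumr big1 // => j _; rewrite compA.
  have [->|ne] := pselect (e \oc i j = 0); first by rewrite comp0l.
  by case: all0; exists j.
have [w wei] := P_coretract (PT j) ej.
(* [T j] is a summand of the image of [e] through [u] and [v]. The remaining idempotent
   [e - u \oc v] vanishes wherever [e] does, and also on [T j]. *)
pose u := e \oc i j; pose v := w \oc e.
have vu1 : v \oc u = idm _ by rewrite /v /u -compA (compA e) ee.
have ve : v \oc e = v by rewrite /v -compA ee.
have eu : e \oc u = u by rewrite /u compA ee.
have ue : u = e \oc i j by [].
clearbody u v; pose e' := e - u \oc v.
have e'e' : e' \oc e' = e'.
  rewrite {1}/e' compBl !compBr ee compA eu -!compA ve (compA v u) vu1 comp1m.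
  by rewrite subrr subr0.
have ve' : v \oc e' = 0 by rewrite compBr ve compA vu1 comp1m subrr.
have e'u : e' \oc u = 0 by rewrite compBl eu -compA vu1 compm1 subrr.
have e'e : e' \oc e = e' by rewrite compBl ee -compA ve.
have [||Z [q [a [qa1 aq]]]] := IHn e'; first exact: e'e'.
  rewrite -ltnS (leq_trans _ le_n) // ltnS; apply: proper_card.
  apply/properP; split.
    apply/subsetP=> l; rewrite !inE; apply/contraNN => /eqP el0.
    by rewrite -e'e -compA el0 comp0r.
  by exists j; rewrite !inE; [apply/eqP|rewrite -e'e -compA -ue e'u eqxx].
have va : v \oc a = 0 by rewrite -(compm1 a) -qa1 (compA a) aq compA ve' comp0l.
have qu : q \oc u = 0 by rewrite -(comp1m q) -qa1 -(compA q) aq -compA e'u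
  comp0r.
have [S TZS] := dsum_fin C_dsum (fun b : bool => if b then T j else Z).
have [i1 [p1 [i2 [p2 [p1i1 p2i2 p1i2 p2i1 sum2]]]]] := (is_dsum2P _ _ _).1 TZS.
exists S, (i1 \oc v + i2 \oc q), (u \oc p1 + a \oc p2).
split; rewrite compDl !compDr -!compA.
  rewrite (compA v u) (compA q u) (compA v a) (compA q a) vu1 qu va qa1.
  by rewrite !comp0l !comp0r !comp1m addr0 add0r.
rewrite (compA p1 i1) (compA p1 i2) (compA p2 i1) (compA p2 i2).
rewrite p1i1 p1i2 p2i1 p2i2 !comp0l !comp0r !comp1m addr0 add0r aq.
by rewrite /e' addrC subrK.
Qed.

(** As [f \oc g \oc f = f], the morphisms killed by [f] are those fixed by [idm X - g \oc f], whose
    image is therefore the kernel. *)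
Lemma kernel_complement X Y (f : Mor X Y) (g : Mor Y X) K (i : Mor K X)
    (p : Mor X K) :
  f \oc g \oc f = f -> p \oc i = idm K -> i \oc p = idm X - g \oc f ->
  is_kernel i f.
Proof.
move=> fgf pi1 ip; split.
  rewrite -(compm1 i) -pi1 (compA i) ip compA compBr compm1 compA fgf.
  by rewrite subrr comp0l.
move=> W h fh0; exists (p \oc h); split=> [|u <-]; last by rewrite comp_cancell.
by rewrite compA ip compBl comp1m -compA fh0 comp0r subr0.
Qed.

Lemma cokernel_complement X Y (f : Mor X Y) (g : Mor Y X) Q (i : Mor Q Y)
    (p : Mor Y Q) :
  f \oc g \oc f = f -> p \oc i = idm Q -> i \oc p = idm Y - f \oc g ->
  is_cokernel f p.
Proof.
move=> fgf pi1 ip; split.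
  rewrite -(comp1m p) -pi1 -(compA p) ip -compA compBl comp1m fgf.
  by rewrite subrr comp0r.
move=> Z h hf0; exists (h \oc i); split=> [|u <-]; last first.
  by rewrite -compA pi1 compm1.
by rewrite -compA ip compBr compm1 compA hf0 comp0l subr0.
Qed.

Lemma complement_idem X (e : Mor X X) :
  e \oc e = e -> (idm X - e) \oc (idm X - e) = idm X - e.
Proof. by move=> ee; rewrite compBl comp1m compBr compm1 ee subrr subr0. Qed.

Lemma monic_split X Y (f : Mor X Y) : monic f -> exists g, g \oc f = idm X.
Proof.
move=> f_mono; have [g fgf] := regular f; exists g; apply: f_mono.
by rewrite compA fgf compm1.
Qed.

Lemma epic_split X Y (f : Mor X Y) : epic f -> exists g, f \oc g = idm Y.
Proof.
move=> f_epi; have [g fgf] := regular f; exists g; apply: f_epi.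
by rewrite fgf comp1m.
Qed.

(** Kernel and cokernel of [f] are the images of [idm X - g \oc f] and [idm Y - f \oc g]. A monic
    [f] is the kernel of the latter, an epic [f] the cokernel of the former. *)
Lemma regular_abelian : abelian_category C.
Proof.
split=> // [X Y f|X Y f|X Y f|X Y f].
- have [g fgf] := regular f.
  have [|K [p [i [pi1 ip]]]] := @split_idempotents X (idm X - g \oc f).
    by apply: complement_idem; rewrite -compA (compA f) fgf.
  by exists K, i; exact: kernel_complement fgf pi1 ip.
- have [g fgf] := regular f.
  have [|Q [p [i [pi1 ip]]]] := @split_idempotents Y (idm Y - f \oc g).
    by apply: complement_idem; rewrite compA fgf.
  by exists Q, p; exact: cokernel_complement fgf pi1 ip.
- move=> /monic_split[g gf1]; exists Y, (idm Y - f \oc g).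
  split; first by rewrite compBl comp1m -compA gf1 compm1 subrr.
  move=> W h /eqP; rewrite compBl comp1m subr_eq0 => /eqP h_eq.
  exists (g \oc h); split=> [|u <-]; first by rewrite compA -h_eq.
  by rewrite comp_cancell.
move=> /epic_split[g fg1]; exists X, (idm X - g \oc f).
split; first by rewrite compBr compm1 compA fg1 comp1m subrr.
move=> Z h /eqP; rewrite compBr compm1 subr_eq0 => /eqP h_eq.
exists (h \oc g); split=> [|u <-]; first by rewrite -compA -h_eq.
by rewrite -compA fg1 compm1.
Qed.

(** A nonzero monic [f] has a left inverse [g], and [f \oc g] is a nonzero idempotent of [S]; it is
    invertible by Schur, hence the identity. *)
Lemma P_simple S : P S -> simple S.
Proof.
move=> PS; split=> [|Y f f_mono]; first exact: P_neq0.
have [g gf1] := monic_split f_mono.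
have [f0|f0] := pselect (f = 0).
  by left; apply/is_zeroP; rewrite -gf1 f0 comp0r.
have fg0 : f \oc g <> 0.
  by move=> fg0; apply: f0; rewrite -(compm1 f) -gf1 compA fg0 comp0l.
have [h [hfg fgh]] := P_schur PS PS fg0.
right; exists g; split=> //.
by rewrite -[LHS](comp_cancell _ hfg) -(compA f g) (compA g f) gf1 comp1m.
Qed.

Lemma semisimple_of_schur : semisimple_category C.
Proof.
move=> X; have [J [Z [PZ ZX]]] := P_dsum X.
exists #|J|, (fun j => Z (enum_val j)); split; last exact: is_dsum_ord.
by move=> j; apply: P_simple.
Qed.

Lemma semisimple_finite_length X : finite_length X.
Proof.
have [n [Z [Zs ZX]]] := semisimple_of_schur X.
elim: n Z Zs X ZX => [|n IHn] Z Zs X ZX.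
  apply: finite_length0; apply/is_zeroP; have [i [p [_ _ <-]]] := ZX.
  by rewrite big_ord0.
have [i [p [pi1 pi0 sum]]] := ZX.
(* Split off the last simple summand; its complement [Y] is the sum of the others. *)
have [Y [j [q [qj1 pj0 qi0 sum2]]]] :=
  idempotent_complement split_idempotents (pi1 ord_max).
apply: (@finite_lengthS _ _ Y X (Z ord_max) j (p ord_max)) (Zs _) _; last first.
  by apply: short_exact_summand qj1 (pi1 _) pj0 _; rewrite addrC.
apply: (IHn (fun l => Z (widen_ord (leqnSn n) l))) => [l|]; first exact: Zs.
have pm l : (widen_ord (leqnSn n) l != ord_max :> 'I_n.+1).
  by rewrite -val_eqE /= neq_ltn ltn_ord.
have jq : j \oc q = idm X - i ord_max \oc p ord_max.
  by rewrite -sum2 addrAC subrr add0r.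
exists (fun l => q \oc i (widen_ord (leqnSn n) l)).
exists (fun l => p (widen_ord (leqnSn n) l) \oc j).
split=> [l|l m neq|].
- rewrite -compA (compA j) jq compBl comp1m compBr pi1 -compA.
  by rewrite pi0 ?comp0r ?subr0 // eq_sym.
- rewrite -compA (compA j) jq compBl comp1m compBr pi0; last first.
    by apply: contraNneq neq => /(congr1 val) /= /ord_inj->.
  by rewrite -compA pi0 ?comp0r ?subr0 // eq_sym.
under eq_bigr => l _ do rewrite -(compA q) (compA (i _)) compA.
rewrite -comp_suml -comp_sumr.
rewrite (_ : \sum_l _ = j \oc q); last by rewrite jq -sum big_ord_recr addrK.
by rewrite -!compA qj1 compm1.
Qed.

(** With [f \oc g \oc f = f], both [g \oc f] and [f \oc g] are nonzero idempotents of simple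
    objects, hence identities. *)
Lemma simple_iso S T (f : Mor S T) : simple S -> simple T -> f <> 0 -> is_iso f.
Proof.
have end1 (X : Ob C) (e : Mor X X) : simple X -> e \oc e = e -> e <> 0 -> e =
  idm X.
  move=> [_ Xs] ee e0; have [Y [p [i [pi1 ip]]]] := split_idempotents ee.
  have i_mono : monic i.
    by move=> W u v iuv; rewrite -(comp_cancell u pi1) iuv comp_cancell.
  have [/is_zeroP Y0|[g [gi1 ig]]] := Xs _ _ i_mono.
    by case: e0; rewrite -ip -(compm1 i) Y0 comp0r comp0l.
  by rewrite -ip -(compm1 p) -ig (compA p) pi1 comp1m ig.
move=> Ss Ts f0; have [g fgf] := regular f; exists g; split; apply: end1 => //.
- by rewrite -compA (compA f) fgf.
- by move=> gf0; apply: f0; rewrite -fgf -compA gf0 comp0r.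
- by rewrite compA fgf.
- by move=> fg0; apply: f0; rewrite -fgf fg0 comp0l.
Qed.

(** The epic [g] has a section [s], and [idm Y - s \oc g] factors through the kernel [f], which
    gives the retraction. *)
Lemma short_exact_dsum2 X Y Z (f : Mor X Y) (g : Mor Y Z) :
  short_exact f g -> is_dsum2 X Z Y.
Proof.
move=> [[gf0 f_ker] [_ g_coker]].
have f_mono : monic f.
  move=> W u v fuv; have [|w [_ w_uniq]] := f_ker _ (f \oc u).
    by rewrite compA gf0 comp0l.
  by rewrite -(w_uniq u) // -(w_uniq v).
have g_epi : epic g.
  move=> W u v ugvg; have [|w [_ w_uniq]] := g_coker _ (u \oc g).
    by rewrite -compA gf0 comp0r.
  by rewrite -(w_uniq u) // -(w_uniq v).
have [s gs1] := epic_split g_epi.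
have [|r [fr _]] := f_ker _ (idm Y - s \oc g).
  by rewrite compBr compm1 compA gs1 comp1m subrr.
apply/is_dsum2P; exists f, r, s, g; split=> //.
- apply: f_mono; rewrite compA fr compBl comp1m -compA gf0 comp0r subr0.
  by rewrite compm1.
- apply: f_mono; rewrite compA fr compBl comp1m -compA gs1 compm1 subrr.
  by rewrite comp0r.
by rewrite fr subrK.
Qed.

Lemma indecomposable_iso X : indecomposable X -> exists S, P S /\ isomorphic X
  S.
Proof.
move=> [X0 Xind]; have [J [Z [PZ [i [p [pi1 pi0 sum]]]]]] := P_dsum X.
have [j _] : exists j : J, true.
  apply: contrapT => noJ; apply/X0/is_zeroP; rewrite -sum big1 // => j.
  by case: noJ; exists j.
have [Y [b [q [qb1 pb0 qi0 sum2]]]] := idempotent_complement split_idempotents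
  (pi1 j).
exists (Z j); split=> //; exists (p j), (i j); split=> //.
have /Xind[/(P_neq0 (PZ j))//|/is_zeroP Y0] : is_dsum2 (Z j) Y X.
  by apply/is_dsum2P; exists (i j), (p j), b, q.
by rewrite -sum2 -(compm1 b) Y0 comp0r comp0l addr0.
Qed.

End SemisimpleCategory.

(** * Dual objects *)

Section MonoidalCategory.
Variables (k : fieldType) (C : moncat k).
Implicit Types W X Y Z U : Ob C.

HB.instance Definition _ X X' Y Y' (f : Mor X X') :=
  GRing.isLinear.Build k (Mor Y Y') (Mor (X \ox Y) (X' \ox Y')) _
    (@tensm k C X X' Y Y' f) (tens_linr f).

Definition tensmr X X' Y Y' (g : Mor Y Y') (f : Mor X X') := f \om g.
HB.instance Definition _ X X' Y Y' (g : Mor Y Y') :=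
  GRing.isLinear.Build k (Mor X X') (Mor (X \ox Y) (X' \ox Y')) _
    (@tensmr X X' Y Y' g) (tens_linl g).

Lemma tens0l X X' Y Y' (g : Mor Y Y') : (0 : Mor X X') \om g = 0.
Proof. exact: (linear0 (tensmr g)). Qed.
Lemma tensZr X X' Y Y' a (f : Mor X X') (g : Mor Y Y') :
  f \om (a *: g) = a *: (f \om g).
Proof. exact: linearZZ. Qed.
Lemma compA_eq X Y Z (a : Mor Y Z) (b : Mor X Y) (c : Mor X Z) :
  a \oc b = c -> forall W (h : Mor W X), a \oc (b \oc h) = c \oc h.
Proof. by move=> <- W h; rewrite compA. Qed.

Lemma comp_invl X Y Z (f : Mor Y Z) (f' : Mor Z Y) (u v : Mor X Y) :
  f' \oc f = idm Y -> f \oc u = f \oc v -> u = v.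
Proof. by move=> f'f fufv; rewrite -(comp_cancell u f'f) fufv comp_cancell. Qed.

Lemma comp_invr X Y Z (f : Mor X Y) (f' : Mor Y X) (u v : Mor Y Z) :
  f \oc f' = idm Y -> u \oc f = v \oc f -> u = v.
Proof.
by move=> ff' ufvf; rewrite -(compm1 u) -(compm1 v) -ff' !compA ufvf.
Qed.

Lemma tens_comp1 X X' X'' Y (f : Mor X' X'') (g : Mor X X') :
  (f \oc g) \om idm Y = (f \om idm Y) \oc (g \om idm Y).
Proof. by rewrite -tens_comp comp1m. Qed.

Lemma tens_1comp X Y Y' Y'' (f : Mor Y' Y'') (g : Mor Y Y') :
  idm X \om (f \oc g) = (idm X \om f) \oc (idm X \om g).
Proof. by rewrite -tens_comp comp1m. Qed.

Lemma tensm_lr X X' Y Y' (f : Mor X X') (g : Mor Y Y') :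
  (f \om idm Y') \oc (idm X \om g) = f \om g.
Proof. by rewrite -tens_comp comp1m compm1. Qed.

Lemma tensm_rl X X' Y Y' (f : Mor X X') (g : Mor Y Y') :
  (idm X' \om g) \oc (f \om idm Y) = f \om g.
Proof. by rewrite -tens_comp comp1m compm1. Qed.

Lemma tens_one_inj X Y (f g : Mor X Y) :
  idm (one C) \om f = idm (one C) \om g -> f = g.
Proof.
move=> fg; apply: (comp_invr (lunitVK X)).
by rewrite -!lunit_nat fg.
Qed.

Lemma tens_inj_one X Y (f g : Mor X Y) :
  f \om idm (one C) = g \om idm (one C) -> f = g.
Proof.
move=> fg; apply: (comp_invr (runitVK X)).
by rewrite -!runit_nat fg.
Qed.

Lemma assocV_nat X X' Y Y' Z Z' (f : Mor X X') (g : Mor Y Y') (h : Mor Z Z') :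
  assocV X' Y' Z' \oc (f \om (g \om h)) = (f \om g \om h) \oc assocV X Y Z.
Proof.
apply: (comp_invr (assocVK X Y Z)).
by rewrite -!compA assocK compm1 -assoc_nat compA assocK comp1m.
Qed.

Lemma lunitV_nat X X' (f : Mor X X') :
  (idm (one C) \om f) \oc lunitV X = lunitV X' \oc f.
Proof.
apply: (comp_invl (lunitK X')).
by rewrite compA lunit_nat -compA lunitVK compm1 compA lunitVK comp1m.
Qed.

Lemma runitV_nat X X' (f : Mor X X') :
  (f \om idm (one C)) \oc runitV X = runitV X' \oc f.
Proof.
apply: (comp_invl (runitK X')).
by rewrite compA runit_nat -compA runitVK compm1 compA runitVK comp1m.
Qed.

(** Kelly's argument: tensoring with the unit is faithful, and after tensoring the pentagon and
    triangle axioms give the identity. *)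
Lemma lunit_assoc X Y : lunit (X \ox Y) \oc assoc (one C) X Y = lunit X \om idm
  Y.
Proof.
apply: tens_one_inj; set W := one C.
have asK : (assoc W (W \ox X) Y \oc (assoc W W X \om idm Y)) \oc
    ((assocV W W X \om idm Y) \oc assocV W (W \ox X) Y) = idm _.
  rewrite -compA (compA (_ \om _)) -tens_comp assocVK comp1m tens1 comp1m.
  exact: assocVK.
apply: (comp_invr asK).
rewrite tens_1comp -compA (compA (idm W \om assoc _ _ _)) -pentagon compA
  triangle.
rewrite -tens1 -assoc_nat -triangle tens_comp1 compA assoc_nat.
by rewrite -compA.
Qed.

Lemma runit_assoc X Y :
  (idm X \om runit Y) \oc assoc X Y (one C) = runit (X \ox Y).
Proof.
apply: tens_inj_one; set W := one C; apply: (comp_invl (assocK X Y W)).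
rewrite tens_comp1 compA assoc_nat -triangle tens_1comp -!compA.
rewrite (compA (idm X \om assoc _ _ _)) -pentagon compA -assoc_nat tens1.
by rewrite -compA triangle.
Qed.

Lemma lunit_one : lunit (one C) = runit (one C).
Proof.
apply: tens_inj_one; rewrite -lunit_assoc -triangle; congr (_ \oc _).
by apply: (comp_invl (lunitK (one C))); rewrite lunit_nat.
Qed.

Lemma assocV_lunitV X Y :
  assocV (one C) X Y \oc lunitV (X \ox Y) = lunitV X \om idm Y.
Proof.
apply: (comp_invl (assocK _ _ _)); apply: (comp_invl (lunitK _)).
rewrite (compA (assoc _ _ _)) assocVK comp1m lunitVK compA lunit_assoc.
by rewrite -tens_comp lunitVK comp1m tens1.
Qed.

Lemma assoc_runitV X Y :
  assoc X Y (one C) \oc runitV (X \ox Y) = idm X \om runitV Y.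
Proof.
apply: (comp_invr (runitVK _)); rewrite -compA runitK compm1 -runit_assoc.
by rewrite compA -tens_comp runitK comp1m tens1 comp1m.
Qed.

Lemma assocV_triangle X Y :
  assocV X (one C) Y \oc (idm X \om lunitV Y) = runitV X \om idm Y.
Proof.
have r1 : (runitV X \om idm Y) \oc (runit X \om idm Y) = idm _.
  by rewrite -tens_comp runitK comp1m tens1.
apply: (comp_invr (f := (runit X \om idm Y)) (f' := (runitV X \om idm Y))).
  by rewrite -tens_comp runitVK comp1m tens1.
rewrite r1 -triangle -compA (compA (idm X \om _)) -tens_comp lunitK comp1m.
by rewrite tens1 comp1m assocK.
Qed.

Lemma pentagonV W X Y Z :
  (idm W \om assocV X Y Z) \oc assoc W X (Y \ox Z) =
  assoc W (X \ox Y) Z \oc (assoc W X Y \om idm Z) \oc assocV (W \ox X) Y Z.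
Proof.
apply: (comp_invr (assocVK (W \ox X) Y Z)).
rewrite -!compA assocK compm1 pentagon -!compA.
by rewrite (compA (idm W \om _)) -tens_comp assocK comp1m tens1 comp1m.
Qed.

Lemma pentagonV' W X Y Z :
  assocV W X (Y \ox Z) \oc (idm W \om assoc X Y Z) =
  assoc (W \ox X) Y Z \oc (assocV W X Y \om idm Z) \oc assocV W (X \ox Y) Z.
Proof.
apply: (comp_invl (assocK _ _ _)); rewrite compA assocVK comp1m !compA pentagon.
rewrite -!compA (compA (assoc W X Y \om _)) -tens_comp assocVK comp1m tens1
  comp1m.
by rewrite assocVK compm1.
Qed.

(** * The adjunction between [X' \ox -] and [X \ox -] *)

Section Duality.
Variables (X X' : Ob C) (ev : Mor (X' \ox X) (one C)) (coev : Mor (one C) (X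
  \ox X')).
Hypothesis dual : duality ev coev.

(** This and [dual_counit] are the unit and counit of the adjunction, [X' \ox -] being the left
    adjoint. *)
Definition dual_unit Z : Mor Z (X \ox (X' \ox Z)) :=
  assoc X X' Z \oc (coev \om idm Z) \oc lunitV Z.
Definition dual_counit Z : Mor (X' \ox (X \ox Z)) Z :=
  lunit Z \oc (ev \om idm Z) \oc assocV X' X Z.

Lemma dual_unit_nat Z Z' (f : Mor Z Z') :
  (idm X \om (idm X' \om f)) \oc dual_unit Z = dual_unit Z' \oc f.
Proof.
rewrite /dual_unit !compA -assoc_nat -!compA -lunitV_nat; congr (_ \oc _).
by rewrite !compA -!tens_comp tens1 !comp1m !compm1.
Qed.

Lemma dual_counit_nat Z Z' (f : Mor Z Z') :
  dual_counit Z' \oc (idm X' \om (idm X \om f)) = f \oc dual_counit Z.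
Proof.
rewrite /dual_counit -!compA assocV_nat !compA -lunit_nat; congr (_ \oc _).
by rewrite -!compA -!tens_comp tens1 !comp1m !compm1.
Qed.

Lemma dual_zigzag1 Z :
  (idm X \om dual_counit Z) \oc dual_unit (X \ox Z) = idm (X \ox Z).
Proof.
rewrite /dual_counit /dual_unit !tens_1comp -!compA.
rewrite (compA_eq (pentagonV _ _ _ _)) -!compA.
rewrite (compA_eq (esym (assoc_nat _ _ _))) -!compA (compA_eq (triangle _ _)).
rewrite -tens1 (compA_eq (assocV_nat _ _ _)) -!compA assocV_lunitV.
by rewrite -!tens_comp1 !compA dual.1 tens1.
Qed.

Lemma dual_zigzag2 Z :
  dual_counit (X' \ox Z) \oc (idm X' \om dual_unit Z) = idm (X' \ox Z).
Proof.
rewrite /dual_counit /dual_unit !tens_1comp -!compA.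
rewrite (compA_eq (pentagonV' _ _ _ _)) -!compA.
rewrite -tens1 (compA_eq (esym (assoc_nat _ _ _))) -!compA (compA_eq
  (lunit_assoc _ _)).
rewrite (compA_eq (assocV_nat _ _ _)) -!compA assocV_triangle.
by rewrite -!tens_comp1 !compA dual.2 tens1.
Qed.

Lemma dim_Mor_dual Y Z :
  \dim {: Mor Z (X \ox Y)} = \dim {: Mor (X' \ox Z) Y}.
Proof.
apply/eqP; rewrite eqn_leq; apply/andP; split.
  refine (@dim_Mor_le _ _ _ _ _ _ (fun h => dual_counit Y \oc (idm X' \om h))
    (fun h => (idm X \om h) \oc dual_unit Z) _ _) => [a u v|h].
    by rewrite tens_linr comp_linr.
  by rewrite tens_1comp -compA dual_unit_nat compA dual_zigzag1 comp1m.
refine (@dim_Mor_le _ _ _ _ _ _ (fun h => (idm X \om h) \oc dual_unit Z)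
  (fun h => dual_counit Y \oc (idm X' \om h)) _ _) => [a u v|h].
  by rewrite tens_linr comp_linl.
by rewrite tens_1comp compA dual_counit_nat -compA dual_zigzag2 compm1.
Qed.

Lemma dual_unit_one : dual_unit (one C) = (idm X \om runitV X') \oc coev.
Proof.
have -> : (idm X \om runitV X') \oc coev =
    assoc X X' (one C) \oc (coev \om idm (one C)) \oc runitV (one C).
  by rewrite -compA runitV_nat compA assoc_runitV.
congr (_ \oc _); apply: (comp_invl (lunitK _)).
by rewrite lunitVK lunit_one runitVK.
Qed.

Lemma dual_counit_one : dual_counit (one C) \oc (idm X' \om runitV X) = ev.
Proof.
rewrite -assoc_runitV /dual_counit -!compA (compA_eq (assocK _ _ _)) comp1m.
by rewrite runitV_nat lunit_one (compA_eq (runitVK _)) comp1m.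
Qed.

(** [h] is the adjunct of [a], with [X'] identified with [X' \ox one C]. *)
Lemma coev_factor U (a : Mor (one C) (X \ox U)) :
  exists h : Mor X' U, a = (idm X \om h) \oc coev.
Proof.
exists (dual_counit U \oc (idm X' \om a) \oc runitV X').
rewrite 2!tens_1comp -!compA -dual_unit_one dual_unit_nat compA.
by rewrite dual_zigzag1 comp1m.
Qed.

Lemma ev_factor Y (b : Mor (X' \ox Y) (one C)) :
  b = ev \oc (idm X' \om (runit X \oc (idm X \om b) \oc dual_unit Y)).
Proof.
rewrite -dual_counit_one -(compA (dual_counit _)) -tens_1comp -(compA (runit
  X)).
rewrite (compA (runitV X)) runitK comp1m tens_1comp (compA (dual_counit _)).
by rewrite dual_counit_nat -(compA b) dual_zigzag2 compm1.
Qed.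

(** [f'] is the transpose of [f]: it is defined by the first identity, and the zigzag relations give
    the second. *)
Lemma dual_mor (f : Mor X X) : exists f' : Mor X' X',
  (f \om idm X') \oc coev = (idm X \om f') \oc coev /\
  ev \oc (f' \om idm X) = ev \oc (idm X' \om f).
Proof.
have [f' f'E] := coev_factor ((f \om idm X') \oc coev); exists f'; split=> //.
rewrite [LHS]ev_factor [RHS]ev_factor; congr (_ \oc (_ \om _)).
have evE : (idm X \om ev) \oc dual_unit X = runitV X.
  apply: (comp_invl (runitK X)); rewrite runitVK -[RHS]dual.1.
  by rewrite /dual_unit !compA.
rewrite -!compA; congr (_ \oc _).
rewrite 2!tens_1comp -!compA dual_unit_nat [RHS]compA evE.
rewrite {1}/dual_unit 2!(compA (idm X \om (f' \om _))) -assoc_nat.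
rewrite -(compA (assoc _ _ _)) -tens_comp1 -f'E tens_comp1 (compA (assoc _ _
  _)).
rewrite assoc_nat tens1 -!compA (compA (assoc _ _ _)) (compA (idm X \om ev)).
rewrite tensm_rl -tensm_lr -!compA -runitV_nat; congr (_ \oc _).
by rewrite -evE /dual_unit -!compA.
Qed.

End Duality.
End MonoidalCategory.

(** * The negligible ideal and partial traces *)

Section BraidedCategory.
Variables (k : fieldType) (C : bmcat k).
Implicit Types U W X Y Z : Ob C.

Lemma br_tens_idl X Y Z (f : Mor X Y) :
  idm Z \om f = brV Z Y \oc (f \om idm Z) \oc br Z X.
Proof.
by rewrite -compA -br_nat (compA (brV _ _)) brK comp1m.
Qed.

Lemma qtraceE X X' (ev : Mor (X' \ox X) (one C)) (coev : Mor (one C) (X \ox X'))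
    (f : Mor X X) :
  qtrace ev coev f = ev \oc br X X' \oc (f \om idm X') \oc coev.
Proof. by rewrite /qtrace -(compA ev _ (br _ _)) -br_nat !compA. Qed.

(* Negligibility without reference to traces.                                 *)
Definition null_pairing X Y (f : Mor X Y) : Prop :=
  forall U (a : Mor (one C) (X \ox U)) (b : Mor (Y \ox U) (one C)),
    b \oc (f \om idm U) \oc a = 0.

Lemma null_pairing0 X Y : null_pairing (0 : Mor X Y).
Proof. by move=> U a b; rewrite tens0l comp0r comp0l. Qed.

Lemma null_pairing_linear X Y c (f g : Mor X Y) :
  null_pairing f -> null_pairing g -> null_pairing (c *: f + g).
Proof.
by move=> nf ng U a b; rewrite tens_linl comp_linr comp_linl nf ng scaler0
  addr0.
Qed.

Lemma null_pairing_compl X Y Z (g : Mor Y Z) (f : Mor X Y) :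
  null_pairing f -> null_pairing (g \oc f).
Proof. by move=> nf U a b; rewrite tens_comp1 (compA b) nf. Qed.

Lemma null_pairing_compr X Y Z (g : Mor Y Z) (f : Mor X Y) :
  null_pairing g -> null_pairing (g \oc f).
Proof. by move=> ng U a b; rewrite tens_comp1 (compA b) -(compA _ _ a) ng. Qed.

Lemma null_pairing_tens1 X Y Z (f : Mor X Y) :
  null_pairing f -> null_pairing (f \om idm Z).
Proof.
move=> nf U a b.
have := nf _ (assoc X Z U \oc a) (b \oc assocV Y Z U).
rewrite -(tens1 Z U) -(compA b) assocV_nat -!compA (compA_eq (assocK _ _ _)).
by rewrite comp1m.
Qed.

(** Conjugation by the braiding turns tensoring on the left into tensoring on the right. *)
Lemma null_pairing_1tens X Y Z (f : Mor X Y) :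
  null_pairing f -> null_pairing (idm Z \om f).
Proof.
move=> nf; rewrite br_tens_idl.
exact/null_pairing_compr/null_pairing_compl/null_pairing_tens1.
Qed.

Lemma null_pairing_unit (f : Mor (one C) (one C)) : null_pairing f -> f = 0.
Proof.
move=> /(_ _ (runitV _) (runit _)).
by rewrite runit_nat -compA runitVK compm1.
Qed.

Lemma null_pairing_ideal : exists I : tensor_ideal C,
  forall X Y (f : Mor X Y), f \in I X Y <-> null_pairing f.
Proof.
have ex X Y : exists U : {vspace Mor X Y}, forall f, f \in U <-> null_pairing f.
  by apply: vspace_of_pred; [exact: null_pairing0|exact: null_pairing_linear].
pose I X Y := projT1 (cid (ex X Y)).
have IP X Y f : f \in I X Y <-> null_pairing f := projT2 (cid (ex X Y)) f.
have Icl X Y Z (g : Mor Y Z) (f : Mor X Y) : f \in I X Y -> g \oc f \in I X Z.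
  by move=> /IP/null_pairing_compl nf; apply/IP.
have Icr X Y Z (g : Mor Y Z) (f : Mor X Y) : g \in I Y Z -> g \oc f \in I X Z.
  by move=> /IP/null_pairing_compr nf; apply/IP.
have Itl X X' Y Y' (f : Mor X X') (g : Mor Y Y') :
    g \in I Y Y' -> f \om g \in I (X \ox Y) (X' \ox Y').
  by move=> /IP/null_pairing_1tens ng; rewrite -tensm_lr; apply: Icl; apply/IP.
have Itr X X' Y Y' (f : Mor X X') (g : Mor Y Y') :
    f \in I X X' -> f \om g \in I (X \ox Y) (X' \ox Y').
  by move=> /IP/null_pairing_tens1 nf; rewrite -tensm_rl; apply: Icl; apply/IP.
by exists (TensorIdeal Icl Icr Itl Itr).
Qed.

(** Factor [a] through [coev], and what remains of [b] through [ev \oc br Y X']; the pairing then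
    becomes the trace of some [g \oc f]. *)
Lemma trace_null_pairing X Y (f : Mor X Y) X' (ev : Mor (X' \ox X) (one C))
    (coev : Mor (one C) (X \ox X')) : duality ev coev ->
  (forall g : Mor Y X, qtrace ev coev (g \oc f) = 0) -> null_pairing f.
Proof.
move=> dual tr0 U a b; have [h ->] := coev_factor dual a.
have [g bE] : exists g, b \oc (idm Y \om h) = ev \oc (idm X' \om g) \oc br Y X'.
  exists (runit X \oc (idm X \om (b \oc (idm Y \om h) \oc brV Y X')) \oc
    dual_unit coev Y).
  by rewrite -(ev_factor dual) -compA brK compm1.
rewrite compA -(compA b) tensm_lr -tensm_rl compA bE -(compA ev) -br_nat compA.
by rewrite -(compA (ev \oc _)) -tens_comp1 -qtraceE tr0.
Qed.

Lemma negligibleP X Y (f : Mor X Y) : rigid C -> negligible f <-> null_pairing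
  f.
Proof.
move=> C_rigid; split=> [nf|nf X' ev coev _ g].
  have [[X' [ev [coev dual]]] _] := C_rigid X.
  by apply: (trace_null_pairing dual) => g; apply: nf.
by rewrite qtraceE tens_comp1 (compA (ev \oc _)) nf.
Qed.

(** * Closing up the strands of a tensor power *)

Section PartialTrace.
Variables (X X' : Ob C) (ev : Mor (X' \ox X) (one C)) (coev : Mor (one C) (X
  \ox X')).
Hypothesis dual : duality ev coev.

Definition ptrace W (h : Mor (W \ox X) (W \ox X)) : Mor W W :=
  runit W \oc ((idm W \om (ev \oc br X X')) \oc (assoc W X X' \oc ((h \om idm
    X')
    \oc (assocV W X X' \oc ((idm W \om coev) \oc runitV W))))).

Lemma ptrace_linear W : linear (@ptrace W).
Proof. by move=> a u v; rewrite /ptrace tens_linl comp_linl !comp_linr. Qed.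

Lemma ptrace_compl W (a : Mor W W) (h : Mor (W \ox X) (W \ox X)) :
  ptrace ((a \om idm X) \oc h) = a \oc ptrace h.
Proof.
rewrite /ptrace tens_comp1 -!compA (compA_eq (assoc_nat _ _ _)) -!compA tens1.
rewrite (compA_eq (tensm_rl a (ev \oc br X X'))) -tensm_lr -!compA.
by rewrite (compA_eq (runit_nat _)) -!compA.
Qed.

Lemma ptrace_compr W (a : Mor W W) (h : Mor (W \ox X) (W \ox X)) :
  ptrace (h \oc (a \om idm X)) = ptrace h \oc a.
Proof.
rewrite /ptrace tens_comp1 -!compA -runitV_nat (compA_eq (tensm_rl a coev)).
rewrite -(tensm_lr a coev) -(tens1 X X') -!compA.
by rewrite (compA_eq (assocV_nat _ _ _)) -!compA.
Qed.

(** Slide [f] around the closed last strand: its transpose passes the cup, then the braiding by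
    naturality, then the cap. *)
Lemma ptrace_cyclic W (f : Mor X X) (h : Mor (W \ox X) (W \ox X)) :
  ptrace ((idm W \om f) \oc h) = ptrace (h \oc (idm W \om f)).
Proof.
have [f' [f'coev evf']] := dual_mor dual f.
have evbr : ev \oc br X X' \oc (f \om idm X') = ev \oc br X X' \oc (idm X \om
  f').
  by rewrite -!compA !br_nat !compA evf'.
rewrite /ptrace !tens_comp1 -!compA; congr (_ \oc _).
rewrite (compA_eq (assoc_nat _ _ _)) -compA (compA_eq (esym (tens_1comp _ _
  _))).
rewrite evbr tens_1comp -compA (compA_eq (esym (assoc_nat _ _ _))) -!compA
  tens1.
rewrite (compA_eq (tensm_rl h f')) -(tensm_lr h f') -!compA -tens1.
rewrite (compA_eq (esym (assocV_nat _ _ _))) -!compA.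
rewrite (compA_eq (esym (tens_1comp _ _ _))) -f'coev (tens_1comp W _ coev)
  -!compA.
by rewrite (compA_eq (assocV_nat _ _ _)) -!compA.
Qed.

Lemma ptrace_tens W (a : Mor W W) (f : Mor X X) t :
  qtrace ev coev f = t *: idm (one C) -> ptrace (a \om f) = t *: a.
Proof.
rewrite qtraceE => trf; rewrite /ptrace (compA_eq (assoc_nat _ _ _)) -!compA.
rewrite (compA_eq (assocVK _ _ _)) comp1m !(compA_eq (esym (tens_comp _ _ _
  _))).
rewrite !compm1 !comp1m.
by rewrite trf tensZr compZl compZr (compA_eq (runit_nat _)) -compA runitVK
  compm1.
Qed.

Lemma ptrace_ideal (I : tensor_ideal C) W (h : Mor (W \ox X) (W \ox X)) :
  h \in I _ _ -> ptrace h \in I _ _.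
Proof.
move=> hI; do 3![apply: ideal_compl]; apply: ideal_compr; exact: ideal_tensr.
Qed.

(** The family is indexed by [nat] so that the recursion keeps it unchanged; only its values below
    [n] matter. *)
Fixpoint tens_family n (g : nat -> Mor X X) :
    Mor (tens_pow X n) (tens_pow X n) :=
  if n is m.+1 then tens_family m g \om g m else idm (one C).

Fixpoint full_trace n : Mor (tens_pow X n) (tens_pow X n) -> Mor (one C) (one
  C) :=
  if n is m.+1 then fun h => full_trace (ptrace h) else id.

Lemma full_trace_linear n : linear (@full_trace n).
Proof. by elim: n => //= n IHn a u v; rewrite ptrace_linear IHn. Qed.

HB.instance Definition _ n := GRing.isLinear.Build k
  (Mor (tens_pow X n) (tens_pow X n)) (Mor (one C) (one C)) _
  (@full_trace n) (@full_trace_linear n).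

(** The last factor moves around by [ptrace_cyclic]; the others leave the partial trace on either
    side and move by induction. *)
Lemma full_trace_cyclic n g (h : Mor (tens_pow X n) (tens_pow X n)) :
  full_trace (tens_family n g \oc h) = full_trace (h \oc tens_family n g).
Proof.
elim: n h => [|n IHn] h /=; first by rewrite comp1m compm1.
rewrite -[in LHS](tensm_lr (tens_family n g) (g n)) -(compA _ _ h) ptrace_compl
  IHn.
by rewrite ptrace_cyclic -ptrace_compr -compA tensm_rl.
Qed.

Lemma full_trace_ideal (I : tensor_ideal C) n (h : Mor (tens_pow X n) (tens_pow
  X n)) :
  h \in I _ _ -> full_trace h \in I _ _.
Proof. by elim: n h => //= n IHn h /ptrace_ideal/IHn. Qed.

Lemma full_trace_const n (f : Mor X X) t : qtrace ev coev f = t *: idm (one C)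
  ->
  full_trace (tens_family n (fun _ => f)) = t ^+ n *: idm (one C).
Proof.
move=> trf; elim: n => [|n IHn] /=; first by rewrite scale1r.
by rewrite (ptrace_tens _ trf) linearZ /= IHn scalerA exprS.
Qed.

Lemma tens_family_comp n g g' :
  tens_family n g \oc tens_family n g' = tens_family n (fun l => g l \oc g' l).
Proof. by elim: n => [|n IHn] /=; rewrite ?comp1m // -tens_comp IHn. Qed.

Lemma eq_tens_family n g g' : (forall l, (l < n)%N -> g l = g' l) ->
  tens_family n g = tens_family n g'.
Proof.
elim: n => //= n IHn gg'; rewrite gg' // IHn // => l ltl.
by apply: gg'; apply: leqW.
Qed.

Lemma tens_family_ideal (I : tensor_ideal C) n g j : (j < n)%N ->
  g j \in I _ _ -> tens_family n g \in I _ _.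
Proof.
elim: n => //= n IHn; rewrite ltnS leq_eqVlt => /predU1P[->|/IHn gI] jI.
  exact: ideal_tensl.
by apply: ideal_tensr; apply: gI.
Qed.

End PartialTrace.
End BraidedCategory.

(** * Lifts of permutations to braidings *)

Section StrandPermutation.
Variables (k : fieldType) (C : bmcat k) (X : Ob C) (f : Mor X X).

Definition on_strand n l : Mor (tens_pow X n) (tens_pow X n) :=
  tens_family n (fun m => if m == l then f else idm X).

Lemma tens_family1 n : tens_family n (fun _ => idm X) = idm (tens_pow X n).
Proof. by elim: n => //= n ->; rewrite tens1. Qed.

Lemma on_strand_lt n l : (l < n)%N -> on_strand n.+1 l = on_strand n l \om idm
  X.
Proof. by move=> ltl; rewrite /on_strand /= gtn_eqF. Qed.

Lemma on_strand_last n : on_strand n.+1 n = idm (tens_pow X n) \om f.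
Proof.
rewrite /on_strand /= eqxx; congr (_ \om _); rewrite -tens_family1.
by apply: eq_tens_family => l ltl; rewrite ltn_eqF.
Qed.

Definition permutes_strands n (b : Mor (tens_pow X n) (tens_pow X n))
    (s : nat -> nat) : Prop :=
  forall l, (l < n)%N -> on_strand n (s l) \oc b = b \oc on_strand n l.

Definition adj_swap i l := if l == i then i.+1 else if l == i.+1 then i else l.

Lemma adjacent_lift n i : (i.+1 < n)%N ->
  exists b b' : Mor (tens_pow X n) (tens_pow X n),
  [/\ b' \oc b = idm _, b \oc b' = idm _ & permutes_strands b (adj_swap i)].
Proof.
(* If the swap concerns the last two strands, braid them; otherwise lift it on the first [n] strands
   and add an idle one. *)
elim: n => // n IHn; rewrite ltnS leq_eqVlt => /predU1P[<- {n IHn}|/[dup] ltin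
  /IHn].
  pose W := tens_pow X i.
  pose b : Mor (W \ox X \ox X) (W \ox X \ox X) :=
    assocV W X X \oc (idm W \om br X X) \oc assoc W X X.
  pose b' : Mor (W \ox X \ox X) (W \ox X \ox X) :=
    assocV W X X \oc (idm W \om brV X X) \oc assoc W X X.
  have b_nat (a : Mor W W) (g h : Mor X X) :
      (a \om g \om h) \oc b = b \oc (a \om h \om g).
    rewrite /b -!compA assoc_nat (compA_eq (esym (assocV_nat _ _ _))) -compA.
    by congr (_ \oc _); rewrite !compA -!tens_comp br_nat comp1m compm1.
  exists b, b'; split.
  - rewrite /b /b' -!compA (compA_eq (assocVK _ _ _)) comp1m.
    by rewrite (compA_eq (esym (tens_1comp _ _ _))) brK tens1 comp1m assocK.
  - rewrite /b /b' -!compA (compA_eq (assocVK _ _ _)) comp1m.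
    by rewrite (compA_eq (esym (tens_1comp _ _ _))) brVK tens1 comp1m assocK.
  move=> l; rewrite ltnS leq_eqVlt /adj_swap => /predU1P[->|].
    rewrite eqxx gtn_eqF // on_strand_last on_strand_lt // on_strand_last
      -tens1.
    exact: b_nat.
  rewrite ltnS leq_eqVlt => /predU1P[->|ltl].
    rewrite eqxx on_strand_last on_strand_lt // on_strand_last -tens1.
    exact: b_nat.
  by rewrite !ltn_eqF ?(leqW ltl) // on_strand_lt ?leqW // on_strand_lt.
move=> [b [b' [b'b bb' bP]]]; exists (b \om idm X), (b' \om idm X).
split; rewrite -?tens_comp1 ?b'b ?bb' ?tens1 // => l.
rewrite ltnS leq_eqVlt /= => /predU1P[->|ltl].
  rewrite /adj_swap !gtn_eqF ?(ltnW ltin) // on_strand_last.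
  by rewrite tensm_lr tensm_rl.
have lts : (adj_swap i l < n)%N by rewrite /adj_swap; do 2?case: ifP => _; lia.
by rewrite !on_strand_lt // -!tens_comp1 bP.
Qed.

Definition liftable n (s : 'S_n) : Prop :=
  exists b b', [/\ b' \oc b = idm (tens_pow X n), b \oc b' = idm (tens_pow X n)
    & forall j : 'I_n, on_strand n (s j) \oc b = b \oc on_strand n j].

Lemma liftable1 n : liftable (1%g : 'S_n).
Proof.
by exists (idm _), (idm _); split=> [||j]; rewrite ?perm1 ?comp1m ?compm1.
Qed.

Lemma liftableM n (s t : 'S_n) : liftable s -> liftable t -> liftable (s * t)%g.
Proof.
move=> [b [b' [b'b bb' bP]]] [c [c' [c'c cc' cP]]].
exists (c \oc b), (b' \oc c'); split=> [||j].
- by rewrite -compA (compA_eq c'c) comp1m.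
- by rewrite -compA (compA_eq bb') comp1m.
by rewrite permM compA cP -compA bP compA.
Qed.

Lemma liftable_tperm n (i j : 'I_n) : liftable (tperm i j).
Proof.
wlog ltij : i j / (i < j)%N.
  case: (ltngtP i j) => [ltij|ltji|/val_inj->]; last 1 first.
  - by rewrite tperm1 => _; exact: liftable1.
  - by apply.
  by rewrite tpermC; apply.
move: ltij; have [d] := ubnP (j - i)%N; elim: d j => // d IHd j; rewrite ltnS
  => led ltij.
have adj (a b : 'I_n) : b = a.+1 :> nat -> liftable (tperm a b).
  move=> ba; have [|c [c' [c'c cc' cP]]] := @adjacent_lift n a.
    by rewrite -ba.
  exists c, c'; split=> // l; rewrite -cP // /adj_swap; congr (on_strand _ _
    \oc _).
  case: tpermP => [->|->|/eqP]; rewrite -?val_eqE /= ?eqxx ?ba //.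
    by rewrite gtn_eqF ?eqxx.
  by move=> /negPf-> /eqP; rewrite -val_eqE /= ba => /negPf->.
have [ji|ltij1] := eqVneq (j : nat) i.+1; first exact: adj.
have ltj1 : (j.-1 < n)%N by apply: leq_ltn_trans (ltn_ord j); exact: leq_pred.
pose m := Ordinal ltj1.
have mj : tperm m j = tperm j m by exact: tpermC.
(* With [m = j - 1], conjugating by the adjacent transposition of [m] and [j] shortens the distance
   from [i]. *)
have -> : tperm i j = (tperm m j * tperm i m * tperm m j)%g.
  have := tpermJ i m (tperm m j); rewrite tpermL tpermD; last 2 first.
  - by rewrite -val_eqE /= neq_ltn; apply/orP; right; lia.
  - by rewrite -val_eqE /= neq_ltn; apply/orP; right; lia.
  by rewrite conjgE tpermV mulgA => <-.
have mj1 : j = m.+1 :> nat by rewrite /= prednK //; lia.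
have lm : liftable (tperm i m) by apply: IHd => /=; lia.
by apply: liftableM (liftableM _ lm) _; apply: adj.
Qed.

Lemma liftable_all n (s : 'S_n) : liftable s.
Proof.
have [ts -> _] := prod_tpermP s.
by elim/big_ind: _ => [|s1 s2|t _]; [exact: liftable1|exact: liftableM|exact:
  liftable_tperm].
Qed.

End StrandPermutation.

(** * Endomorphisms with negligible square have trace zero *)

Section ModerateGrowth.
Variables (k : fieldType) (C : bmcat k) (I : tensor_ideal C).
Hypothesis I1 : forall f : Mor (one C) (one C), f \in I _ _ -> f = 0.
Hypothesis C_unit : scalar_unit C.
Variables (X X' : Ob C) (ev : Mor (X' \ox X) (one C)) (coev : Mor (one C) (X
  \ox X')).
Hypothesis dual : duality ev coev.

Lemma scalar_unitP (f : Mor (one C) (one C)) : exists t, f = t *: idm (one C).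
Proof. by have [s _ sK] := C_unit; exists (s f); rewrite sK. Qed.

Lemma scalar_unit_eq0 t : t *: idm (one C) = 0 -> t = 0.
Proof. by move=> t0; apply: (bij_inj C_unit); rewrite t0 scale0r. Qed.

(* With s i = j <> i, sliding g from strand i through b and around the        *)
(* closure brings two copies of g together on strand i.                       *)
Lemma full_trace_strands (g : Mor X X) n b (s : 'S_n) :
  g \oc g \in I X X -> s != 1%g ->
  (forall j : 'I_n, on_strand g n (s j) \oc b = b \oc on_strand g n j) ->
  full_trace ev coev (tens_family n (fun _ => g) \oc b) = 0.
Proof.
move=> gg s1 bP; have [i si] : exists i, s i != i.
  apply/existsP; apply: contraR s1; rewrite negb_exists => /forallP s1.
  by apply/eqP/permP => i; rewrite perm1; apply/eqP; rewrite -[_ == _]negbK s1.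
pose h (l : nat) := if (l == i) || (l == s i) then idm X else g.
have -> : tens_family n (fun _ => g) =
    tens_family n h \oc on_strand g n i \oc on_strand g n (s i).
  rewrite !tens_family_comp; apply: eq_tens_family => l _; rewrite /h.
  have [->|] := eqVneq l (i : nat); first by rewrite eq_sym val_eqE (negPf si)
    comp1m compm1.
  by have [->|] := eqVneq l (s i : nat); rewrite !(comp1m, compm1).
rewrite -!compA bP !compA -full_trace_cyclic // !compA !tens_family_comp.
apply/I1/full_trace_ideal/ideal_compr; apply: (tens_family_ideal (ltn_ord i)).
by rewrite /h !eqxx /= compm1.
Qed.

Lemma trace_square_zero (g : Mor X X) :
  moderate_growth_obj X -> g \oc g \in I X X -> qtrace ev coev g = 0.
Proof.
move=> [n dim_lt] gg; have [t trg] := scalar_unitP (qtrace ev coev g).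
have [t0|/eqP t0] := eqVneq t 0; first by rewrite trg t0 scale0r.
have /choice[b] := fun s : 'S_n => liftable_all g s.
move=> /choice[b' bP].
pose V := [tuple b (enum_val i) | i < #|{: 'S_n}|].
have Vi (i : 'I_#|{: 'S_n}|) : V`_i = b (enum_val i) by rewrite -tnth_nth
  tnth_mktuple.
have [a [sum_a [u au]]] : exists a : 'I_#|{: 'S_n}| -> k,
    \sum_i a i *: V`_i = 0 /\ exists i, a i <> 0.
  apply: contrapT => no_a; move: dim_lt; rewrite ltnNge => /negP; apply.
  have /eqP : free V.
    apply/freeP => a sum_a i; apply: contrapT => ai.
    by apply: no_a; exists a; split=> //; exists i.
  have <- : #|{: 'S_n}| = n`! by rewrite -card_Sn; exact: eq_card.
  by rewrite size_tuple => dimV; rewrite -[X in (X <= _)%N]dimV;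
    apply/dimvS/subvf.
case: au; pose F := tens_family n (fun _ => g).
have := congr1 (fun h => full_trace ev coev (F \oc (b' (enum_val u) \oc h)))
  sum_a.
rewrite !comp0r linear0 !comp_sumr linear_sum (bigD1 u) //= big1 => [|i iu];
  last first.
  have [b'b bb' bE] := bP (enum_val i); have [c'c cc' cE] := bP (enum_val u).
  rewrite Vi !compZr linearZ /= (full_trace_strands (s := enum_val i *
    (enum_val u)^-1)%g) ?scaler0 //.
    by rewrite -eq_mulgV1 (inj_eq enum_val_inj).
  (* The lift of [s] followed by the inverse of the lift of [u] carries strands along [s * u^-1]. *)
  move=> j; rewrite permM; set m := enum_val i j.
  have := cE ((enum_val u)^-1%g m); rewrite permKV => cm.
  rewrite -[RHS]compA -bE -/m !compA; congr (_ \oc _).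
  by rewrite -[LHS]comp1m -c'c -!compA (compA_eq (esym cm)) -compA cc' compm1.
have [c'c cc' cE] := bP (enum_val u).
rewrite addr0 Vi !compZr c'c compm1 linearZ /= (full_trace_const _ trg) scalerA.
move=> /scalar_unit_eq0/eqP; rewrite mulf_eq0 => /orP[/eqP//|].
by rewrite expf_eq0 => /andP[_ /eqP].
Qed.

End ModerateGrowth.

(** * The ring spanned by a multiplicative family *)

Section RingOfClasses.
Variables (O : Type) (V : zmodType) (cl : O -> V) (mul : O -> O -> O) (e : O).
Variable lam : O -> {additive V -> V}.
Hypothesis cl_mul : forall x y, cl (mul x y) = lam x (cl y).
Hypothesis cl_mulC : forall x y, cl (mul x y) = cl (mul y x).
Hypothesis cl_mulA : forall x y z, cl (mul x (mul y z)) = cl (mul (mul x y) z).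
Hypothesis cl_mul1 : forall x, cl (mul e x) = cl x.

Definition comb (s : seq (O * int)) : V := \sum_(x <- s) cl x.1 *~ x.2.

Definition spanned : {pred V} := fun v => `[< exists s, v = comb s >].

Lemma spannedP v : reflect (exists s, v = comb s) (v \in spanned).
Proof. exact: asboolP. Qed.

Lemma combE x : comb [:: (x, 1)] = cl x.
Proof. by rewrite /comb big_seq1. Qed.

Lemma spanned_cl x : cl x \in spanned.
Proof. by apply/spannedP; exists [:: (x, 1)]; rewrite combE. Qed.

Fact spanned_zmod_closed : zmod_closed spanned.
Proof.
split=> [|u v /spannedP[s ->] /spannedP[t ->]].
  by apply/spannedP; exists [::]; rewrite /comb big_nil.
apply/spannedP; exists (s ++ [seq (x.1, - x.2) | x <- t]).
rewrite /comb big_cat big_map /= -sumrN; congr (_ + _).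
by apply: eq_bigr => x _; rewrite mulrNz.
Qed.
HB.instance Definition _ := GRing.isZmodClosed.Build V spanned
  spanned_zmod_closed.

Lemma eq_spanned (W : zmodType) (f g : {additive V -> W}) v :
  (forall x, f (cl x) = g (cl x)) -> v \in spanned -> f v = g v.
Proof.
move=> fg /spannedP[s ->]; rewrite !raddf_sum; apply: eq_bigr => x _.
by rewrite !raddfMz fg.
Qed.

(** A chosen decomposition of [v]; the empty list is a default outside the span. *)
Definition repr_comb v : seq (O * int) :=
  if pselect (exists s, v = comb s) is left ex then projT1 (cid ex) else [::].

Lemma repr_combK v : v \in spanned -> comb (repr_comb v) = v.
Proof.
move=> /spannedP ex; rewrite /repr_comb; case: pselect => // ex'.
by rewrite -(projT2 (cid ex')).
Qed.

Definition vmul (v w : V) : V := \sum_(x <- repr_comb v) lam x.1 w *~ x.2.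

Fact vmul_additive v : zmod_morphism (vmul v).
Proof.
move=> u w; rewrite /vmul -sumrB; apply: eq_bigr => x _.
by rewrite raddfB mulrzBl.
Qed.
HB.instance Definition _ v := GRing.isZmodMorphism.Build V V (vmul v)
  (vmul_additive v).

(* The left factor of vmul is decomposed through a choice, so the symmetric   *)
(* formula below shows independence of it.                                    *)
Lemma vmul_cl v x : v \in spanned -> vmul v (cl x) = lam x v.
Proof.
move=> vS; rewrite -[in RHS](repr_combK vS) /vmul raddf_sum.
by apply: eq_bigr => y _; rewrite raddfMz -!cl_mul cl_mulC.
Qed.

Lemma vmulC v w : v \in spanned -> w \in spanned -> vmul v w = vmul w v.
Proof.
move=> vS wS; rewrite -[in LHS](repr_combK wS) /comb raddf_sum /vmul /=.
by apply: eq_bigr => x _; rewrite raddfMz; congr (_ *~ _); apply: vmul_cl.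
Qed.

Lemma lam_spanned x v : v \in spanned -> lam x v \in spanned.
Proof.
move=> /spannedP[s ->]; rewrite raddf_sum rpred_sum // => y _.
by rewrite raddfMz rpredMz // -cl_mul spanned_cl.
Qed.

Lemma vmul_spanned v w : w \in spanned -> vmul v w \in spanned.
Proof.
by move=> wS; rewrite rpred_sum // => y _; rewrite rpredMz // lam_spanned.
Qed.

Lemma lam_mul x y v : v \in spanned -> lam x (lam y v) = lam (mul x y) v.
Proof.
apply: (@eq_spanned _ (lam x \o lam y) (lam (mul x y))) => z /=.
by rewrite -!cl_mul cl_mulA.
Qed.

(** By additivity take [w = cl z]; both sides are then [lam (mul x z) v]. *)
Lemma vmul_lam x v w : v \in spanned -> w \in spanned ->
  vmul v (lam x w) = lam x (vmul v w).
Proof.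
move=> vS; apply: (@eq_spanned _ (vmul v \o lam x) (lam x \o vmul v)) => z /=.
by rewrite -cl_mul !vmul_cl // lam_mul.
Qed.

Lemma vmulA u v w : u \in spanned -> v \in spanned -> w \in spanned ->
  vmul u (vmul v w) = vmul (vmul u v) w.
Proof.
move=> uS vS; apply: (@eq_spanned _ (vmul u \o vmul v) (vmul (vmul u v))) => z
  /=.
by rewrite !vmul_cl ?vmul_lam ?vmul_spanned.
Qed.

Definition green : Type := {v : V | v \in spanned}.
HB.instance Definition _ := Choice.on green.
HB.instance Definition _ := SubType.on green.
HB.instance Definition _ := [SubChoice_isSubZmodule of green by <:].

Lemma green_valP (r : green) : sval r \in spanned.
Proof. exact: valP. Qed.

Definition gmul (r s : green) : green := Sub (vmul (val r) (val s))
  (vmul_spanned _ (valP s)).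
Definition gcl x : green := Sub (cl x) (spanned_cl x).

Fact gmulA : associative gmul.
Proof. by move=> r s t; apply: val_inj; rewrite /= vmulA ?green_valP. Qed.
Fact gmulC : commutative gmul.
Proof. by move=> r s; apply: val_inj; rewrite /= vmulC ?green_valP. Qed.
Fact gmul1 : left_id (gcl e) gmul.
Proof.
move=> r; rewrite gmulC; apply: val_inj; rewrite /= vmul_cl ?green_valP //.
by apply: (@eq_spanned _ (lam e) idfun); [move=> z; rewrite -cl_mul
  cl_mul1|exact: green_valP].
Qed.
Fact gmulDl : left_distributive gmul +%R.
Proof.
move=> r s t; rewrite gmulC !(gmulC _ t); apply: val_inj.
by rewrite /= !raddfD.
Qed.
HB.instance Definition _ := GRing.Zmodule_isComPzRing.Build green gmulA gmulC
  gmul1 gmulDl.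

Lemma gcl_mul x y : gcl (mul x y) = gcl x * gcl y.
Proof.
by apply: val_inj; rewrite /= vmul_cl ?spanned_cl // -cl_mul cl_mulC.
Qed.

Lemma green_span (r : green) : exists s, r = \sum_(x <- s) gcl x.1 *~ x.2.
Proof.
have /spannedP[s rE] := green_valP r; exists s; apply: val_inj.
by rewrite [LHS]rE raddf_sum; apply: eq_bigr => x _; rewrite raddfMz.
Qed.

(** The injection [v] is part of the conclusion because equalities between classes are tested in
    [V]. *)
Lemma ring_of_classes : exists (R : pzRingType) (c : O -> R) (v : {additive R
  -> V}),
  [/\ injective v, forall x, v (c x) = cl x, c e = 1,
      forall x y, c (mul x y) = c x * c y
    & forall r : R, exists s : seq (O * int), r = \sum_(x <- s) c x.1 *~ x.2].
Proof.
exists green, gcl, (val : green -> V); split.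
- exact: val_inj.
- by [].
- by [].
- exact: gcl_mul.
exact: green_span.
Qed.

End RingOfClasses.

(** * Nilpotent endomorphisms are negligible *)

Section LocalEndomorphisms.
Variables (k : fieldType) (C : bmcat k) (I : tensor_ideal C).
Hypothesis IP : forall X Y (f : Mor X Y), f \in I X Y <-> null_pairing f.
Hypotheses (C_rigid : rigid C) (C_unit : scalar_unit C).
Implicit Types X Y S T : Ob C.

Definition local_end S := forall g : Mor S S, nilp g \/ is_iso g.

(** [u^n \oc g^n] is the identity for every [n]. *)
Lemma left_inv_nilp S (u g : Mor S S) : u \oc g = idm S -> nilp g -> idm S = 0.
Proof.
move=> ug [n gn0]; rewrite -[RHS](comp0r S (endpow u n)) -gn0.
elim: n {gn0} => [|n IHn]; first by rewrite comp1m.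
by rewrite endpowSr endpowS -compA (compA_eq ug) comp1m.
Qed.

Lemma nilp_compl S (u g : Mor S S) : local_end S -> nilp g -> nilp (u \oc g).
Proof.
move=> /(_ (u \oc g))[//|[v [vug _]]] gn.
(* If [u \oc g] were invertible, [g] would have a left inverse and [S] would be zero; then already
   the power of exponent 0, the identity, vanishes. *)
by exists 0%N; apply: (@left_inv_nilp _ (v \oc u) g); rewrite -?compA.
Qed.

Lemma nilp_comp_sym S T (f : Mor S T) (g : Mor T S) :
  nilp (f \oc g) -> nilp (g \oc f).
Proof.
move=> [n fg0]; exists n.+1.
have -> : endpow (g \oc f) n.+1 = g \oc endpow (f \oc g) n \oc f.
  elim: {fg0} n => [|n IHn]; first by rewrite /= !compm1.
  by rewrite endpowS IHn endpowS !compA.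
by rewrite fg0 comp0r comp0l.
Qed.

(** Modulo [I], iterating [x = w \oc x] gives [x = w^n \oc x = 0]. *)
Lemma nilp_mod_ideal S (w x : Mor S S) :
  nilp w -> x - w \oc x \in I S S -> x \in I S S.
Proof.
move=> [n wn0] xI; suff : x - endpow w n \oc x \in I S S.
  by rewrite wn0 comp0l subr0.
elim: n {wn0} => [|n IHn]; first by rewrite comp1m subrr mem0v.
rewrite endpowS -(subrKA (w \oc x)) -[w \oc endpow w n \oc x]compA -compBr
  memvD //.
exact: ideal_compl.
Qed.

Lemma qtrace_eq0 S S' (ev : Mor (S' \ox S) (one C)) (coev : Mor (one C) (S \ox
  S'))
    (g : Mor S S) : duality ev coev -> moderate_growth_obj S -> g \oc g \in I S
      S ->
  qtrace ev coev g = 0.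
Proof.
move=> dual growS; apply: (trace_square_zero _ C_unit dual growS).
by move=> f /IP; exact: null_pairing_unit.
Qed.

Lemma not_ideal_trace S T (f : Mor S T) S' (ev : Mor (S' \ox S) (one C))
    (coev : Mor (one C) (S \ox S')) : duality ev coev -> f \notin I S T ->
  exists g : Mor T S, qtrace ev coev (g \oc f) <> 0.
Proof.
move=> dual fI; apply: contrapT => no_g; move/negP: fI; apply; apply/IP.
apply: (trace_null_pairing dual) => g; apply: contrapT => gf.
by apply: no_g; exists g.
Qed.

(* Take f nilpotent outside I generating a left ideal of least dimension      *)
(* modulo I, and g = h f with nonzero trace. If g^2 is not in I, it generates *)
(* the same left ideal as f modulo I, so g - u g^2 is in I for some u, and    *)
(* then g is in I since u g is nilpotent.                                     *)
Lemma nilp_ideal S (f : Mor S S) :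
  local_end S -> moderate_growth_obj S -> nilp f -> f \in I S S.
Proof.
move=> locS growS nf; apply: contrapT => fI; have [[S' [ev [coev dual]]] _] :=
  C_rigid S.
pose L (f : Mor S S) := (limg (linfun (precomp f) : 'Hom(Mor S S, Mor S S)) + I
  S S)%VS.
have LP g x : reflect (exists u, exists2 n, n \in I S S & x = u \oc g + n) (x
  \in L g).
  apply: (iffP memv_addP) => [[_ /memv_imgP[u _ ->] [n nI ->]]|[u [n nI ->]]].
    by exists u, n => //; rewrite lfunE.
  exists (u \oc g); last by exists n.
  by apply/memv_imgP; exists u; rewrite ?memvf // lfunE.
have [{nf fI}{}f [nf fI f_min]] : exists f, [/\ nilp f, f \notin I S S &
    forall g, nilp g -> g \notin I S S -> (\dim (L f) <= \dim (L g))%N].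
  pose Q n := `[< exists f, [/\ nilp f, f \notin I S S & \dim (L f) = n] >].
  have exQ : exists n, Q n.
    by exists (\dim (L f)); apply/asboolP; exists f; split=> //; exact/negP.
  have [n /asboolP[g [ng gI <-]] n_min] := ex_minnP exQ; exists g; split=> // h
    nh hI.
  by apply: n_min; apply/asboolP; exists h.
have [h trhf] := not_ideal_trace dual fI; pose g := h \oc f; rewrite -/g in
  trhf.
have ng : nilp g by exact: nilp_compl.
have [ggI|ggI] := boolP (g \oc g \in I S S).
  by apply: trhf; apply: qtrace_eq0.
have LggLf : (L (g \oc g) <= L f)%VS.
  apply/subvP => x /LP[u [n nI ->]]; apply/LP; exists (u \oc g \oc h), n => //.
  by rewrite -!compA.
have /eqP Lgg : L (g \oc g) == L f.
  by rewrite eqEdim LggLf f_min //; exact: nilp_compl.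
have /LP[u [n nI gE]] : g \in L (g \oc g).
  by rewrite Lgg; apply/LP; exists h, 0; rewrite ?mem0v // addr0.
clearbody g; apply: trhf; apply: qtrace_eq0 => //; apply: ideal_compl.
apply: (@nilp_mod_ideal _ (u \oc g)); first exact: nilp_compl.
by rewrite -compA {1}gE addrAC subrr add0r.
Qed.

(** Some [g \oc f] has nonzero trace, so it is not nilpotent, and neither is [f \oc g]. Both are
    then invertible, which makes [f] invertible. *)
Lemma not_ideal_iso S T (f : Mor S T) : local_end S -> local_end T ->
  moderate_growth_obj S -> f \notin I S T -> is_iso f.
Proof.
move=> locS locT growS fI; have [[S' [ev [coev dual]]] _] := C_rigid S.
have [g trgf] := not_ideal_trace dual fI.
have gf_nil : ~ nilp (g \oc f).
  move=> /(nilp_ideal locS growS) gfI; apply: trgf; apply: qtrace_eq0 => //.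
  exact: ideal_compl.
have [//|[a [agf _]]] := locS (g \oc f).
have [/nilp_comp_sym//|[b [_ fgb]]] := locT (f \oc g).
have ab : a \oc g = g \oc b.
  by rewrite -[LHS]compm1 -fgb !compA -(compA a) agf comp1m.
exists (g \oc b); split; first by rewrite -ab -compA.
by rewrite compA.
Qed.

End LocalEndomorphisms.

(** * The semisimplification *)

Lemma fct_mulrz (T : Type) (f : T -> int) (n : int) x : (f *~ n) x = f x *~ n.
Proof.
have fM m : (f *+ m) x = f x *+ m by elim: m => // m IHm; rewrite !mulrS -IHm.
case: n => m; first exact: fM.
by rewrite NegzE !mulrNz; congr (- _); exact: fM.
Qed.

Lemma isomorphic_tens_pow (k : fieldType) (C : moncat k) (X Y : Ob C) n :
  isomorphic X Y -> isomorphic (tens_pow X n) (tens_pow Y n).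
Proof.
move=> [f [g [gf fg]]]; elim: n => [|n [f' [g' [g'f' f'g']]]] /=.
  exact: isomorphic_refl.
by exists (f' \om f), (g' \om g); rewrite -!tens_comp gf fg g'f' f'g' !tens1.
Qed.

(** * What passes to the quotient by a tensor ideal *)

Section Quotient.
Variables (k : fieldType) (C : moncat k) (I : tensor_ideal C).
Notation D := (quot_moncat I).
Implicit Types X Y Z S : Ob C.

Lemma comp_qpi X Y Z (g : Mor Y Z) (f : Mor X Y) :
  @comp k D X Y Z (qpi I g) (qpi I f) = qpi I (g \oc f).
Proof. exact: qcompE. Qed.

Lemma tens_qpi X X' Y Y' (f : Mor X X') (g : Mor Y Y') :
  @tensm k D X X' Y Y' (qpi I f) (qpi I g) = qpi I (f \om g).
Proof. exact: qtensmE. Qed.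

HB.instance Definition _ X Y :=
  GRing.isLinear.Build k (Mor X Y) (qMor I X Y) _ (@qpi k C I X Y) (@qpi_linear
    k C I X Y).

Lemma quot_is_dsum (J : finType) (Z : J -> Ob C) S :
  is_dsum Z S -> @is_dsum k D J Z S.
Proof.
move=> [i [p [pi1 pi0 sum]]]; exists (fun j => qpi I (i j)), (fun j => qpi I (p
  j)).
split=> [j|j l neq|]; rewrite ?comp_qpi ?pi1 ?pi0 //; first exact: (linear0
  (@qpi k C I _ _)).
rewrite -[RHS]/(qpi I (idm S)) -sum [RHS](linear_sum (@qpi k C I _ _)).
by apply: eq_bigr => j _; exact: comp_qpi.
Qed.

Lemma quot_isomorphic X Y : isomorphic X Y -> @isomorphic k D X Y.
Proof.
by move=> [f [g [gf fg]]]; exists (qpi I f), (qpi I g); rewrite !comp_qpi gf fg.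
Qed.

Lemma quot_is_zero X : @is_zero k D X <-> idm X \in I X X.
Proof. by rewrite is_zeroP -qpi_eq0. Qed.

Lemma quot_has_direct_sums : has_direct_sums C -> has_direct_sums D.
Proof. by move=> C_dsum n Z; have [S ZS] := C_dsum n Z; exists S; exact:
  quot_is_dsum. Qed.

Lemma quot_duality X X' (ev : Mor (X' \ox X) (one C)) (coev : Mor (one C) (X
  \ox X')) :
  duality ev coev -> @duality k D X' X (qpi I ev) (qpi I coev).
Proof.
move=> [zig zag]; split.
  rewrite -[RHS]/(qpi I (idm X)) -[X in _ = qpi I X]zig.
  by rewrite -!comp_qpi -!tens_qpi.
rewrite -[RHS]/(qpi I (idm X')) -[X in _ = qpi I X]zag.
by rewrite -!comp_qpi -!tens_qpi.
Qed.

Lemma quot_rigid : rigid C -> rigid D.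
Proof.
move=> C_rigid X; have [[X' [ev [coev /quot_duality d]]] [Y' [ev' [coev'
  /quot_duality d']]]] := C_rigid X.
split; first by exists X', (qpi I ev), (qpi I coev).
by exists Y', (qpi I ev'), (qpi I coev').
Qed.

Lemma quot_scalar_unit : (forall f : Mor (one C) (one C), f \in I _ _ -> f = 0)
  ->
  scalar_unit C -> scalar_unit D.
Proof.
move=> I1 C_unit; have piZ a : a *: idm (one D) = qpi I (a *: idm (one C)).
  by rewrite [RHS]linearZ.
have [s sK Ks] := C_unit.
exists (fun q : qMor I (one C) (one C) => s (generic_quotient.repr q)) =>
  [a|q]; last first.
  by rewrite piZ Ks /qpi quotv_repr.
rewrite piZ; apply: (canLR sK); apply/subr0_eq/I1.
exact: quotv_repr_pi.
Qed.

Lemma quot_tens_pow X n : @tens_pow k D X n = tens_pow X n.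
Proof. by elim: n => //= n ->. Qed.

Lemma dim_quot_le X Y : (\dim {: @Mor k D X Y} <= \dim {: Mor X Y})%N.
Proof.
pose f := (linfun (@qpi k C I X Y) : 'Hom(Mor X Y, qMor I X Y)).
rewrite -(limg_ker_dim f fullv) -[X in (X <= _)%N]add0n leq_add //.
apply: dimvS; apply/subvP => q _; have [h ->] := qpiP q.
by apply/memv_imgP; exists h; rewrite ?memvf // lfunE.
Qed.

End Quotient.

Section Semisimplification.
Variables (k : fieldType) (C : bmcat k) (I : tensor_ideal C).
Hypothesis IP : forall X Y (f : Mor X Y), f \in I X Y <-> null_pairing f.
Hypotheses (C_rigid : rigid C) (C_cauchy : cauchy_complete C).
Hypotheses (C_unit : scalar_unit C) (C_growth : moderate_growth C).
Notation D := (quot_bmcat I).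
Implicit Types X Y Z S T : Ob C.

Let I1 (f : Mor (one C) (one C)) : f \in I _ _ -> f = 0.
Proof. by move=> /IP/null_pairing_unit. Qed.

(** If [idm X] is in [I], any summand [one C] of [Y \ox X] has its identity in [I], which is absurd.
    Otherwise some pairing [b \oc a] is a nonzero scalar; rescaled and braided, it splits [one C]
    off [U \ox X]. *)
Lemma non_negligibleP X : indecomposable X -> non_negligible X <-> idm X \notin
  I X X.
Proof.
move=> Xind; split=> [[_ [Y [Z /is_dsum2P[i [p [j [q [pi1 _ _ _ _]]]]]]]]|XI].
  apply/negP => XI; have id0 : idm (one C) = 0.
    apply: I1; rewrite -pi1 -(comp1m i) -tens1; apply: ideal_compl.
    by apply: ideal_compr; apply: ideal_tensl.
  move/eqP: (oner_neq0 k); apply; apply: (scalar_unit_eq0 C_unit).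
  by rewrite id0 scaler0.
split=> //; have [U [a [b ba]]] : exists U (a : Mor (one C) (X \ox U))
    (b : Mor (X \ox U) (one C)), b \oc a <> 0.
  apply: contrapT => no_ab; move/negP: XI; apply; apply/IP => U a b.
  rewrite tens1 compm1; apply: contrapT => ba; apply: no_ab.
  by exists U, a, b.
have [t tE] := scalar_unitP C_unit (b \oc a).
have t0 : t != 0 by apply/eqP => t0; apply: ba; rewrite tE t0 scale0r.
pose i := br X U \oc a; pose p := t^-1 *: (b \oc brV X U).
have pi1 : p \oc i = idm (one C).
  rewrite compZl /i -compA (compA_eq (brK _ _)) comp1m tE scalerA mulVf //.
  by rewrite scale1r.
have [Z [j [q [qj1 pj0 qi0 sum]]]] := idempotent_complement C_cauchy.2 pi1.
by exists U, Z; apply/is_dsum2P; exists i, p, j, q.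
Qed.

Lemma non_negligible_local S : non_negligible S -> local_end S.
Proof.
move=> [Sind _] g; apply: nilp_or_iso => e; exact: indecomposable_idem
  C_cauchy.2 Sind.
Qed.

Let P_neq0 S : non_negligible S -> ~ @is_zero k D S.
Proof.
by move=> nS /quot_is_zero; apply/negP; apply/non_negligibleP => //; have [] :=
  nS.
Qed.

(** Invertibility holds in [C] itself, which gives Schur's lemma in the quotient and also the
    comparison of isomorphism classes. *)
Lemma non_negligible_lift S T (f : Mor S T) : non_negligible S ->
  non_negligible T ->
  f \notin I S T -> is_iso f.
Proof.
move=> nS nT; apply: (not_ideal_iso IP C_rigid C_unit).
- exact: non_negligible_local.
- exact: non_negligible_local.
by have [Sind _] := nS; exact: C_growth.
Qed.

Let P_schur S T (f : @Mor k D S T) : non_negligible S -> non_negligible T ->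
  f <> 0 -> is_iso f.
Proof.
have [h ->] := qpiP f => nS nT f0.
have [|g [gh hg]] := @non_negligible_lift S T h nS nT.
  by apply/negP => /qpi_eq0.
exists (qpi I g); split.
  by rewrite [LHS]comp_qpi gh.
by rewrite [LHS]comp_qpi hg.
Qed.

Lemma quot_non_negligible_dsum (J : finType) (Z : J -> Ob C) X :
  (forall j, indecomposable (Z j)) -> is_dsum Z X ->
  @is_dsum k D {j | `[< non_negligible (Z j) >]} (fun j => Z (val j)) X.
Proof.
move=> indZ ZX; apply: is_dsum_support (quot_is_dsum I ZX) => j nZ.
apply/quot_is_zero; apply: contraNT nZ => ZI; apply/asboolP.
exact/non_negligibleP.
Qed.

Let P_dsum X : exists (J : finType) (Z : J -> Ob C),
  (forall j, non_negligible (Z j)) /\ @is_dsum k D J Z X.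
Proof.
have [J [Z [indZ ZX]]] := indecomposable_dsum X.
exists {j | `[< non_negligible (Z j) >]}, (fun j => Z (val j)); split.
  by move=> [j jP]; exact/asboolP.
exact: quot_non_negligible_dsum.
Qed.

Let D_dsum : has_direct_sums D.
Proof. exact/quot_has_direct_sums/C_cauchy.1. Qed.

Lemma quot_semisimple : semisimple_category D.
Proof. exact: (@semisimple_of_schur k D (@non_negligible k C)) P_neq0 P_schur
  P_dsum. Qed.

Lemma quot_tensor_category : tensor_category D.
Proof.
split.
- exact: (@regular_abelian k D (@non_negligible k C)) D_dsum P_schur P_dsum.
- exact: quot_rigid.
- exact: (@semisimple_finite_length k D (@non_negligible k C)) D_dsum P_neq0
  P_schur P_dsum.
exact: quot_scalar_unit.
Qed.

(** An indecomposable object of the quotient is isomorphic there to a non-negligible one of [C], and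
    passing to the quotient does not increase dimensions of Hom spaces. *)
Lemma quot_moderate_growth : moderate_growth D.
Proof.
move=> X /(@indecomposable_iso k D (@non_negligible k C) D_dsum P_neq0 P_schur
  P_dsum)[S [nS XS]].
have [n dim_lt] := C_growth nS.1; exists n.
have XSn := @isomorphic_tens_pow k D X S n XS.
rewrite (dim_Mor_iso XSn XSn); apply: leq_ltn_trans dim_lt.
by rewrite quot_tens_pow dim_quot_le.
Qed.

Lemma quot_isomorphic_lift S T : non_negligible S -> non_negligible T ->
  @isomorphic k D S T -> isomorphic S T.
Proof.
move=> nS nT [f [g [gf fg]]]; have [h fE] := qpiP f; exists h.
apply: non_negligible_lift => //; apply/negP => /qpi_eq0 h0; apply: (P_neq0 nS).
by apply/is_zeroP; rewrite -gf fE h0 comp0r.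
Qed.

(** * The Grothendieck ring inside integer functions on objects *)

Definition ldual X : Ob C := projT1 (cid (C_rigid X).1).

Lemma dim_quot_dual X Y Z :
  \dim {: @Mor k D Z (X \ox Y)} = \dim {: @Mor k D (ldual X \ox Z) Y}.
Proof.
have [ev [coev dual]] := projT2 (cid (C_rigid X).1).
exact: dim_Mor_dual (quot_duality I dual) Y Z.
Qed.

Definition hom_dim X : Ob C -> int := fun Z => (\dim {: @Mor k D Z X})%:Z.

(** Multiplication by the class of [X] on such functions: by duality, Hom from [Z] to [X \ox Y] is
    Hom from [ldual X \ox Z] to [Y]. *)
Definition dual_shift X (v : Ob C -> int) : Ob C -> int := fun Z => v (ldual X
  \ox Z).

Fact dual_shift_additive X : zmod_morphism (dual_shift X).
Proof. by []. Qed.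
HB.instance Definition _ X :=
  GRing.isZmodMorphism.Build (Ob C -> int) (Ob C -> int) (dual_shift X)
    (dual_shift_additive X).

Lemma hom_dim_mul X Y : hom_dim (X \ox Y) = dual_shift X (hom_dim Y).
Proof. by apply/funext => Z; rewrite /hom_dim dim_quot_dual. Qed.

Lemma hom_dim_iso X Y : @isomorphic k D X Y -> hom_dim X = hom_dim Y.
Proof.
move=> XY; apply/funext => Z; rewrite /hom_dim; congr Posz.
by apply: dim_Mor_iso XY; exact: isomorphic_refl.
Qed.

Lemma hom_dim_mulC X Y : hom_dim (X \ox Y) = hom_dim (Y \ox X).
Proof. by apply/hom_dim_iso/quot_isomorphic/(iso_isomorphic (brK _ _) (brVK _
  _)). Qed.

Lemma hom_dim_mulA X Y Z : hom_dim (X \ox (Y \ox Z)) = hom_dim (X \ox Y \ox Z).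
Proof.
by apply/hom_dim_iso/quot_isomorphic/(iso_isomorphic (assocVK _ _ _) (assocK _
  _ _)).
Qed.

Lemma hom_dim_mul1 X : hom_dim (one C \ox X) = hom_dim X.
Proof. by apply/hom_dim_iso/quot_isomorphic/(iso_isomorphic (lunitK _) (lunitVK
  _)). Qed.

Lemma hom_dim_dsum (J : finType) (Z : J -> Ob C) S :
  @is_dsum k D J Z S -> hom_dim S = \sum_j hom_dim (Z j).
Proof.
move=> ZS; apply/funext => W; rewrite fct_sumE /hom_dim (@dim_Mor_dsum k D _ _
  _ W ZS).
exact: (big_morph Posz PoszD).
Qed.

Lemma hom_dim_eq0 S T : (forall f : @Mor k D T S, f = 0) -> hom_dim S T = 0.
Proof.
move=> f0; rewrite /hom_dim (_ : fullv = 0%VS) ?dimv0 //.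
by apply/eqP; rewrite -subv0; apply/subvP => f _; rewrite [f]f0 mem0v.
Qed.

Lemma hom_dim_neq0 S : ~ @is_zero k D S -> hom_dim S S <> 0.
Proof.
move=> S0 [/eqP]; rewrite dimv_eq0 => /eqP full0; apply/S0/is_zeroP/eqP.
by rewrite -memv0 -full0 memvf.
Qed.

Lemma green_ring_exists : exists (R : pzRingType) (cl : Ob C -> R),
  is_green_ring C cl /\ is_grothendieck_ring D cl.
Proof.
have [R [cl [v [v_inj vcl cl1 clM clS]]]] :=
  ring_of_classes hom_dim_mul hom_dim_mulC hom_dim_mulA hom_dim_mul1.
have cl_dsum (J : finType) (Z : J -> Ob C) S : @is_dsum k D J Z S ->
    cl S = \sum_j cl (Z j).
  move=> ZS; apply: v_inj; rewrite vcl raddf_sum (hom_dim_dsum ZS).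
  by apply: eq_bigr => j _.
have cl_iso X Y : @isomorphic k D X Y -> cl X = cl Y.
  by move=> XY; apply: v_inj; rewrite !vcl (hom_dim_iso XY).
have cl_span r : exists n (X : 'I_n -> Ob C) (a : 'I_n -> int),
    (forall i, non_negligible (X i)) /\ r = \sum_i cl (X i) *~ a i.
  (* Replace each object in a combination by the non-negligible summands of its decomposition in the
     quotient. *)
  have [s ->] := clS r; pose J X := projT1 (cid (P_dsum X)).
  pose Z X : J X -> Ob C := projT1 (cid (projT2 (cid (P_dsum X)))).
  have ZX X : (forall j, non_negligible (Z X j)) /\ @is_dsum k D (J X) (Z X) X.
    exact: projT2 (cid (projT2 (cid (P_dsum X)))).
  pose t i := tnth (in_tuple s) i; pose K : finType := {i : 'I_(size s) & J (t
    i).1}.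
  exists #|K|, (fun u => Z _ (tagged (enum_val u))), (fun u => (t (tag
    (enum_val u))).2).
  split=> [u|]; first by case: (ZX (t (tag (enum_val u))).1).
  transitivity (\sum_(u : K) cl (Z _ (tagged u)) *~ (t (tag u)).2); last first.
    rewrite (reindex (@enum_val K (mem K))) //; exact: onW_bij (@enum_val_bij
      K).
  rewrite big_tnth -(@sig_big_dep _ _ _ _ _ xpredT (fun _ => xpredT)
    (fun i j => cl (Z (t i).1 j) *~ (t i).2)) /=.
  apply: eq_bigr => i _; rewrite (cl_dsum _ _ _ (ZX (t i).1).2).
  exact: mulrz_suml.
have nn_simple S : non_negligible S -> @simple k D S.
  exact: (@P_simple k D (@non_negligible k C)) P_neq0 P_schur P_dsum _.
have cl_free n (X : 'I_n -> Ob C) (a : 'I_n -> int) :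
    (forall i, @simple k D (X i)) ->
    (forall i j, @isomorphic k D (X i) (X j) -> i = j) ->
    \sum_i cl (X i) *~ a i = 0 -> forall i, a i = 0.
  (* Evaluate the relation at [X i]: Schur's lemma kills the other terms, and [hom_dim (X i) (X i)]
     is nonzero. *)
  move=> Xs X_iso sum0 i; have := congr1 (fun r => v r (X i)) sum0.
  rewrite raddf0 raddf_sum fct_sumE (bigD1 i) //= big1 => [|j ji].
    rewrite raddfMz vcl addr0 fct_mulrz => /eqP.
    rewrite mulrz_eq0 => /orP[/eqP//|/eqP /hom_dim_neq0[]]; exact: (Xs i).1.
  rewrite raddfMz vcl fct_mulrz hom_dim_eq0 ?mul0rz // => f.
  apply: contrapT => f0; move/eqP: ji; apply; apply: X_iso.
  apply: isomorphic_sym; exists f.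
  exact: (@simple_iso k D (@non_negligible k C)) D_dsum P_schur P_dsum _ _ _ _
    _ f0.
exists R, cl; split; split=> //.
- split=> [X Y _ _ XY|n X a nX X_iso|//]; first exact/cl_iso/quot_isomorphic.
  apply: cl_free => [i|i j ij]; first exact: nn_simple.
  by apply: X_iso; exact: quot_isomorphic_lift.
- move=> X Y nX nY n Z indZ ZXY; rewrite -clM.
  by rewrite [RHS]big_sub_val; apply: cl_dsum; exact: quot_non_negligible_dsum.
- split=> [X Y _ _|n X a|r]; [exact: cl_iso|exact: cl_free|].
  have [n [X [a [nX rE]]]] := cl_span r; exists n, X, a; split=> // i.
  exact: nn_simple.
move=> X Y Z f g /(@short_exact_dsum2 k D (@non_negligible k C) P_schur P_dsum)
  XZY.
by rewrite (cl_dsum _ _ _ XZY) big_bool.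
Qed.

End Semisimplification.

Theorem corollary1p7 (k : closedFieldType) (C : bmcat k)
    (C_rigid : rigid C) (C_cauchy : cauchy_complete C)
    (C_unit : scalar_unit C) (C_growth : moderate_growth C) :
  exists I : tensor_ideal C,
    (forall (X Y : Ob C) (f : Mor X Y), f \in I X Y <-> negligible f) /\
    let Cbar : bmcat k := quot_bmcat I in
    [/\ semisimple_category Cbar,
        tensor_category Cbar,
        moderate_growth Cbar
      & exists (R : pzRingType) (cl : Ob C -> R),
          is_green_ring C cl /\ is_grothendieck_ring Cbar cl].
Proof.
have [I IP] := null_pairing_ideal C; exists I; split=> [X Y f|].
  by rewrite IP negligibleP.
split.
- exact: quot_semisimple.
- exact: quot_tensor_category.
- exact: quot_moderate_growth.
exact: green_ring_exists.
Qed.
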